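(* Let $k\ge 2$, $\Sigma=\{\sigma_1,\dots,\sigma_k\}$, and let $R_k(z)=\sum_{\alpha\in\mathrm{RE}_{na}} z^{|\alpha|}$ be the generating function of the set $\mathrm{RE}_{na}$ defined below. Then $$[z^n]R_k(z) \sim \frac{\sqrt{\psi_k(\eta_k)}}{8\eta_k\sqrt{\pi}}\, n^{-3/2}\,\eta_k^{-n}\qquad (n\to\infty).$$
   Context: Regular expressions over $\Sigma$ are generated by $\beta := \varepsilon \mid \sigma\ (\sigma\in\Sigma) \mid (\beta+\beta) \mid (\beta\cdot\beta) \mid (\beta^\star)$ (the empty-set expression is not counted). The size $|\beta|$ is the number of occurrences of the symbols $\varepsilon$, letters, $+$, $\cdot$, $\star$ in $\beta$ (parentheses not counted). A $\Sigma$-star expression is an expression $(\tau^\star)$ where $\tau$ is a fully parenthesized union of the $k$ letters, each occurring exactly once, in any order and any bracketing; there are $C_k:=\frac{(2k-2)!}{(k-1)!}$ of them, each of size $2k$. $\mathrm{RE}_{na}$ is the set of regular expressions having no subexpression $(\beta_1+\beta_2)$ in which $\beta_1$ or $\beta_2$ is a $\Sigma$-star expression. Define the polynomials $p_k(z)=1-2z-(7+8k)z^2$, $h_k(z)=1-z-C_k z^{2k+1}$, and $\Delta_k(z)=p_k(z)+4z^{2k+1}C_k h_k(z)$. Let $\eta_k$ be the unique real root of $\Delta_k$ in the open interval $\left(0,\frac{1}{\sqrt{8+8k}}\right)$, and set $\psi_k(\eta_k):=-\eta_k\Delta_k'(\eta_k)$. $[z^n]F(z)$ denotes the coefficient of $z^n$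 in $F$, and $a_n\sim b_n$ means $a_n/b_n\to 1$. *)

(* Defs.v *)
From Stdlib Require Import Reals Lra Lia List Arith.
From Coquelicot Require Import Coquelicot.
Open Scope R_scope.

(* Regular expressions over the alphabet {0,...,k-1} (letters are nats;
   well-formedness w.r.t. k is the predicate [letters_ok k]).
   The empty-set expression is not included. *)
Inductive re : Type :=
| Eps : re
| Lit : nat -> re
| Plus : re -> re -> re
| Cat : re -> re -> re
| Star : re -> re.

Fixpoint rsize (e : re) : nat :=
  match e with
  | Eps => 1%nat
  | Lit _ => 1%nat
  | Plus a b => (rsize a + rsize b + 1)%nat
  | Cat a b => (rsize a + rsize b + 1)%nat
  | Star a => (rsize a + 1)%nat
  end.

Fixpoint letters_ok (k : nat) (e : re) : Prop :=
  match e with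
  | Eps => True
  | Lit i => (i < k)%nat
  | Plus a b => letters_ok k a /\ letters_ok k b
  | Cat a b => letters_ok k a /\ letters_ok k b
  | Star a => letters_ok k a
  end.

Fixpoint union_of_letters (t : re) : Prop :=
  match t with
  | Lit _ => True
  | Plus a b => union_of_letters a /\ union_of_letters b
  | _ => False
  end.

Fixpoint occ (i : nat) (e : re) : nat :=
  match e with
  | Eps => 0%nat
  | Lit j => if Nat.eqb i j then 1%nat else 0%nat
  | Plus a b => (occ i a + occ i b)%nat
  | Cat a b => (occ i a + occ i b)%nat
  | Star a => occ i a
  end.

Definition sigma_star (k : nat) (e : re) : Prop :=
  match e with
  | Star t => union_of_letters t /\ letters_ok k t /\
              (forall i, (i < k)%nat -> occ i t = 1%nat)
  | _ => False
  end.

Fixpoint re_na (k : nat) (e : re) : Prop :=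
  match e with
  | Eps => True
  | Lit _ => True
  | Plus a b => ~ sigma_star k a /\ ~ sigma_star k b /\ re_na k a /\ re_na k b
  | Cat a b => re_na k a /\ re_na k b
  | Star a => re_na k a
  end.

Definition Ck (k : nat) : R := INR (fact (2 * k - 2) / fact (k - 1)).

Definition pk (k : nat) (z : R) : R := 1 - 2 * z - (7 + 8 * INR k) * z ^ 2.
Definition hk (k : nat) (z : R) : R := 1 - z - Ck k * z ^ (2 * k + 1).
Definition Deltak (k : nat) (z : R) : R :=
  pk k z + 4 * z ^ (2 * k + 1) * Ck k * hk k z.

Definition psik (k : nat) (eta : R) : R := - eta * Derive (Deltak k) eta.

Definition asym (k : nat) (eta : R) (n : nat) : R :=
  sqrt (psik k eta) / (8 * eta * sqrt PI) * Rpower (INR n) (- 3 / 2) / eta ^ n.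

(* Main.v *)
(* The recursive description of RE_na gives
     R = (k+1) z + z R + z R^2 + z (R - S)^2,   S = C_k z^(2k),
   so [D = 1 - z + 2 z S - 4 z R] satisfies [D^2 = Delta_k]. Since eta is a root,
   [Q = Delta_k / (1 - z/eta)] is a polynomial, with [Q(eta) = psi_k(eta)], and
   [D = sqrt (1 - z/eta) G] with [G^2 = Q]. No complex analysis is needed to see
   that [G] converges beyond eta: at [|z| = eta] the coefficients of [Q - 1] have
   absolute sum less than 1, because [C_k eta^(2k+1)] is tiny and the dominant one is
   [1 - 2 eta], and then the partial absolute sums of [G - 1] stay below 1. Hence
   [[z^n] D] is asymptotic to [G(eta)] times the coefficients of [sqrt (1 - z/eta)],
   whose size is given by Wallis' formula. *)
Require Import Defs.
From Stdlib Require Import Reals Lra Lia List FinFun Arith.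
From Stdlib Require Import FunctionalExtensionality ClassicalEpsilon.
From Coquelicot Require Import Coquelicot.
Open Scope R_scope.

(** * Formal power series *)

(** The usual route has to show that [eta] is the only singularity in a closed disc. A strict
    inequality between real numbers replaces this. In [y = z / eta], dividing [Delta_k] by [1 - y]
    turns its coefficients into partial sums. The coefficients sum to 0 because [eta] is a root, so
    [Q] has coefficient [1 - 2 eta] in degree 1, coefficients of order [w = C_k eta^(2k+1)] in
    degrees 2 to [4k+1], and 0 beyond. Their absolute sum is at most [1 - 2 eta + 24 k w], and
    everything rests on [12 k w < eta]. The slack below 1 buys a radius larger than 1 in [y], which
    absorbs the polynomial weights when coefficients are compared. The same estimates give
    [psi_k > 0] and the sign of [G] at the singularity. The constant: [sqrt (1 - y)] has
    coefficients close to [- n^(-3/2) / (2 sqrt pi)], and the coefficient of [D] at [y^(n+1)] is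
    [-4 eta] times [a_n eta^n]. Hence the factor [1 / (8 eta sqrt pi)]. *)

Definition fps := nat -> R.

Definition mono (c : R) (m : nat) : fps := fun n => if Nat.eqb n m then c else 0.
Definition fps_add (f g : fps) : fps := fun n => f n + g n.
Definition fps_opp (f : fps) : fps := fun n => - f n.
Definition fps_sub (f g : fps) : fps := fun n => f n - g n.
Definition fps_mul (f g : fps) : fps :=
  fun n => sum_f_R0 (fun i => f i * g (n - i)%nat) n.

Declare Scope fps_scope.
Delimit Scope fps_scope with fps.
Bind Scope fps_scope with fps.
Infix "+" := fps_add : fps_scope.
Infix "-" := fps_sub : fps_scope.
Infix "*" := fps_mul : fps_scope.
Notation "- f" := (fps_opp f) : fps_scope.
Notation "1" := (mono 1%R 0) : fps_scope.
Notation "'X'" := (mono 1%R 1) : fps_scope.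

(** Removal of the constant term followed by division by [X]. With [fps_mul_S], convolution
    identities follow by induction on the index, for all series at once, and no double sum is ever
    exchanged. *)
Definition shift (f : fps) : fps := fun n => f (S n).

Lemma fps_mul_S (f g : fps) (n : nat) :
  (f * g)%fps (S n) = f 0%nat * g (S n) + (shift f * g)%fps n.
Proof.
  unfold fps_mul. rewrite decomp_sum by lia. reflexivity.
Qed.

Lemma fps_mul_S_r (f g : fps) (n : nat) :
  (f * g)%fps (S n) = (f * shift g)%fps n + f (S n) * g 0%nat.
Proof.
  unfold fps_mul. rewrite tech5, Nat.sub_diag. f_equal.
  apply sum_eq; intros i Hi. unfold shift.
  now replace (S n - i)%nat with (S (n - i)) by lia.
Qed.

Lemma fps_mulC (f g : fps) : (f * g = g * f)%fps.
Proof.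
  apply functional_extensionality; intros n.
  revert f g; induction n as [|n IH]; intros f g.
  - unfold fps_mul; simpl; ring.
  - rewrite fps_mul_S, fps_mul_S_r, IH. ring.
Qed.

Lemma fps_mulDl (f g h : fps) : ((f + g) * h = f * h + g * h)%fps.
Proof.
  apply functional_extensionality; intros n. unfold fps_add, fps_mul.
  rewrite <- sum_plus. apply sum_eq; intros i _. ring.
Qed.

Lemma fps_mulA (f g h : fps) : (f * (g * h) = (f * g) * h)%fps.
Proof.
  apply functional_extensionality; intros n.
  revert f; induction n as [|n IH]; intros f.
  - unfold fps_mul; simpl; ring.
  - rewrite (fps_mul_S (f * g)), (fps_mul_S f (g * h)), IH, fps_mul_S.
    replace (shift (f * g)) with ((fun m => (f 0%nat * shift g m)%R) + shift f * g)%fps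
      by (apply functional_extensionality; intros m; symmetry; apply fps_mul_S).
    rewrite fps_mulDl. unfold fps_add at 1.
    replace (((fun m => (f 0%nat * shift g m)%R) * h)%fps n)
      with (f 0%nat * (shift g * h)%fps n).
    + unfold fps_mul at 4; simpl; ring.
    + unfold fps_mul. rewrite scal_sum. apply sum_eq; intros i _. ring.
Qed.

Lemma fps_mul_mono (c : R) (m : nat) (f : fps) (n : nat) :
  (mono c m * f)%fps n = if Nat.leb m n then c * f (n - m)%nat else 0.
Proof.
  revert c m; induction n as [|n IH]; intros c m.
  - unfold fps_mul, mono; destruct m; simpl; ring.
  - rewrite fps_mul_S. destruct m as [|m].
    + simpl Nat.leb. replace (shift (mono c 0)) with (mono 0 0)
        by (apply functional_extensionality; intros [|j]; reflexivity).
      rewrite IH. unfold mono; simpl; ring.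
    + change (shift (mono c (S m))) with (mono c m). rewrite IH.
      unfold mono; simpl; ring.
Qed.

Lemma fps_mul1 (f : fps) : (1 * f = f)%fps.
Proof.
  apply functional_extensionality; intros n.
  rewrite fps_mul_mono. simpl. rewrite Nat.sub_0_r. ring.
Qed.

Lemma mono_mul (c d : R) (m p : nat) :
  (mono c m * mono d p)%fps = mono (c * d) (m + p).
Proof.
  apply functional_extensionality; intros n.
  rewrite fps_mul_mono. unfold mono.
  destruct (Nat.leb_spec m n); destruct (Nat.eqb_spec (n - m) p);
    destruct (Nat.eqb_spec n (m + p)); try lia; ring.
Qed.

(** By extensionality, equality of series is Leibniz equality, so [ring] can check identities
    between generating functions. *)
Lemma fps_ring_theory :
  ring_theory (mono 0 0) (mono 1 0) fps_add fps_mul fps_sub fps_opp (@eq fps).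
Proof.
  constructor; intros;
    try (apply functional_extensionality; intros n;
         unfold fps_add, fps_sub, fps_opp, mono; try destruct (Nat.eqb n 0); ring).
  - apply fps_mul1.
  - apply fps_mulC.
  - apply fps_mulA.
  - apply fps_mulDl.
Qed.

Add Ring fps_ring : fps_ring_theory.

Lemma mono_add (c d : R) (m : nat) : (mono c m + mono d m = mono (c + d) m)%fps.
Proof.
  apply functional_extensionality; intros n. unfold fps_add, mono.
  destruct (Nat.eqb n m); ring.
Qed.

Lemma mono_opp (c : R) (m : nat) : (- mono c m = mono (- c) m)%fps.
Proof.
  apply functional_extensionality; intros n. unfold fps_opp, mono.
  destruct (Nat.eqb n m); ring.
Qed.

(** Substitution of [r z] for [z], a ring morphism. With [r = eta] it moves the singularity to 1. *)
Definition scale (r : R) (f : fps) : fps := fun n => f n * r ^ n.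

Lemma scale_add (r : R) (f g : fps) : (scale r (f + g) = scale r f + scale r g)%fps.
Proof. apply functional_extensionality; intros n. unfold scale, fps_add. ring. Qed.

Lemma scale_sub (r : R) (f g : fps) : (scale r (f - g) = scale r f - scale r g)%fps.
Proof. apply functional_extensionality; intros n. unfold scale, fps_sub. ring. Qed.

Lemma scale_mul (r : R) (f g : fps) : (scale r (f * g) = scale r f * scale r g)%fps.
Proof.
  apply functional_extensionality; intros n. unfold scale, fps_mul.
  rewrite Rmult_comm, scal_sum. apply sum_eq; intros i Hi.
  replace (r ^ n) with (r ^ i * r ^ (n - i))
    by (rewrite <- pow_add; f_equal; lia).
  ring.
Qed.

Lemma scale_mono (r c : R) (m : nat) : scale r (mono c m) = mono (c * r ^ m) m.
Proof.
  apply functional_extensionality; intros n. unfold scale, mono.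
  destruct (Nat.eqb_spec n m) as [->|]; ring.
Qed.

(** The series of [1 / (1 - X)]; multiplication by it forms partial sums of coefficients. *)
Definition geom : fps := fun _ => 1.

Lemma geom_inv : (geom * (1 - X) = 1)%fps.
Proof.
  replace (geom * (1 - X))%fps with (geom - X * geom)%fps by ring.
  apply functional_extensionality; intros n. unfold fps_sub.
  rewrite fps_mul_mono. unfold geom, mono. destruct n; simpl; ring.
Qed.

Lemma mono_mul_geom (c : R) (m n : nat) :
  (mono c m * geom)%fps n = if Nat.leb m n then c else 0.
Proof. rewrite fps_mul_mono. unfold geom. destruct (Nat.leb m n); ring. Qed.

(** * Finite cardinalities *)

(* The cardinality is a real, so that convolutions of cardinalities are [fps_mul]. *)
Definition has_card {A : Type} (P : A -> Prop) (x : R) : Prop :=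
  exists l : list A, NoDup l /\ INR (length l) = x /\ forall e, In e l <-> P e.

(** Counting one set in two ways thereby yields an equation between coefficients. *)
Lemma has_card_unique {A : Type} (P : A -> Prop) (x y : R) :
  has_card P x -> has_card P y -> x = y.
Proof.
  intros (l & Hl & <- & El) (l' & Hl' & <- & El'). f_equal.
  apply Nat.le_antisymm; apply NoDup_incl_length; trivial;
    intros e He; [apply El', El | apply El, El']; trivial.
Qed.

Lemma has_card_ext {A : Type} (P Q : A -> Prop) (x : R) :
  (forall e, P e <-> Q e) -> has_card P x -> has_card Q x.
Proof.
  intros H (l & Hl & Hx & El). exists l; repeat split; trivial; intros He.
  - apply H, El, He.
  - apply El, H, He.
Qed.

Lemma has_card_empty {A : Type} (P : A -> Prop) :
  (forall e, ~ P e) -> has_card P 0.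
Proof.
  intros H. exists nil; repeat split.
  - constructor.
  - intros [].
  - intros He; destruct (H _ He).
Qed.

Lemma has_card_or {A : Type} (P Q : A -> Prop) (x y : R) :
  has_card P x -> has_card Q y -> (forall e, P e -> Q e -> False) ->
  has_card (fun e => P e \/ Q e) (x + y).
Proof.
  intros (l & Hl & <- & El) (l' & Hl' & <- & El') H.
  exists (l ++ l'); repeat split.
  - apply NoDup_app; trivial.
    intros e He He'. apply (H e); [apply El | apply El']; trivial.
  - now rewrite length_app, plus_INR.
  - intros He. apply in_app_or in He.
    destruct He; [left; apply El | right; apply El']; trivial.
  - intros He. apply in_or_app.
    destruct He; [left; apply El | right; apply El']; trivial.
Qed.

Lemma has_card_minus {A : Type} (P Q : A -> Prop) (x y : R) :
  has_card P x -> has_card Q y -> (forall e, Q e -> P e) ->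
  has_card (fun e => P e /\ ~ Q e) (x - y).
Proof.
  intros (l & Hl & <- & El) HQ H.
  (* [Q] is an arbitrary predicate, so the boolean test for [filter] has to come from classical
     logic. *)
  set (inQ := fun e => if excluded_middle_informative (Q e) then true else false).
  assert (H1 : y = INR (length (filter inQ l))).
  { apply (has_card_unique Q); trivial.
    exists (filter inQ l); repeat split.
    - now apply NoDup_filter.
    - intros He. apply filter_In in He. unfold inQ in He.
      destruct (excluded_middle_informative (Q e)); [trivial | easy].
    - intros He. apply filter_In. unfold inQ.
      destruct (excluded_middle_informative (Q e)); [|easy].
      split; [apply El, H |]; trivial. }
  exists (filter (fun e => negb (inQ e)) l); repeat split.
  - now apply NoDup_filter.
  - rewrite <- (filter_length inQ l), plus_INR, H1. ring.
  - apply filter_In in H0. now apply El.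
  - apply filter_In in H0. unfold inQ in H0.
    now destruct (excluded_middle_informative (Q e)).
  - intros [He He']. apply filter_In. unfold inQ.
    destruct (excluded_middle_informative (Q e)); [easy |].
    split; [apply El|]; trivial.
Qed.

Lemma has_card_image {A B : Type} (f : A -> B) (P : A -> Prop) (x : R) :
  (forall a b, f a = f b -> a = b) -> has_card P x ->
  has_card (fun e => exists a, P a /\ e = f a) x.
Proof.
  intros Hf (l & Hl & <- & El). exists (map f l); repeat split.
  - now apply Injective_map_NoDup.
  - now rewrite length_map.
  - intros He. apply in_map_iff in He. destruct He as (a & <- & Ha).
    exists a; split; [apply El|]; trivial.
  - intros (a & Ha & ->). apply in_map, El, Ha.
Qed.

Lemma has_card_prod {A B : Type} (P : A -> Prop) (Q : B -> Prop) (x y : R) :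
  has_card P x -> has_card Q y ->
  has_card (fun e => P (fst e) /\ Q (snd e)) (x * y).
Proof.
  intros (l & Hl & <- & El) (l' & Hl' & <- & El').
  exists (list_prod l l'); repeat split.
  - clear El. induction Hl as [|a l Ha Hl IH]; simpl; [constructor|].
    apply NoDup_app; trivial.
    + apply Injective_map_NoDup; trivial. now intros ? ? [= ->].
    + intros e He He'. apply in_map_iff in He. destruct He as (b & <- & Hb).
      now apply in_prod_iff in He'.
  - now rewrite length_prod, mult_INR.
  - destruct e as [a b]. apply in_prod_iff in H. now apply El.
  - destruct e as [a b]. apply in_prod_iff in H. now apply El'.
  - destruct e as [a b]. intros [Ha Hb]. apply in_prod; [apply El|apply El']; trivial.
Qed.

(** The symbolic product rule for a binary constructor [f]. The classes for different [i] are
    disjoint because [f] is injective and the members of [A i] have size [i], so their cardinalities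
    add up to a convolution. *)
Lemma has_card_conv (f : re -> re -> re) (A B : nat -> re -> Prop) (a b : fps) (n : nat) :
  (forall x y x' y', f x y = f x' y' -> x = x' /\ y = y') ->
  (forall i x, A i x -> rsize x = i) ->
  (forall i, has_card (A i) (a i)) -> (forall i, has_card (B i) (b i)) ->
  has_card (fun e => exists i x y,
    (i <= n)%nat /\ A i x /\ B (n - i)%nat y /\ e = f x y) ((a * b)%fps n).
Proof.
  intros Hf HA Ha Hb. unfold fps_mul.
  (* The upper end of the sum is separated from the total [n], which must stay fixed during the
     induction. *)
  enough (H : forall p, has_card (fun e => exists i x y,
    (i <= p)%nat /\ A i x /\ B (n - i)%nat y /\ e = f x y)
    (sum_f_R0 (fun i => a i * b (n - i)%nat) p)) by apply H.
  assert (H : forall i, has_card (fun e => exists u, (A i (fst u) /\ B (n - i)%nat (snd u))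
     /\ e = f (fst u) (snd u)) (a i * b (n - i)%nat)).
  { intros i. apply has_card_image.
    - intros [x y] [x' y'] E. apply Hf in E. simpl in E. now destruct E as [-> ->].
    - now apply has_card_prod. }
  induction p as [|p IH].
  - simpl sum_f_R0. eapply has_card_ext; [|apply (H 0%nat)].
    intros e; split.
    + intros ([x y] & [Hx Hy] & ->). exists 0%nat, x, y; auto.
    + intros (i & x & y & Hi & Hx & Hy & ->). assert (i = 0%nat) as -> by lia. now exists (x, y).
  - rewrite tech5. eapply has_card_ext; [|apply (has_card_or _ _ _ _ IH (H (S p)))].
    + intros e; split.
      * intros [(i & x & y & Hi & Hx & Hy & ->) | ([x y] & [Hx Hy] & ->)].
        -- exists i, x, y; auto.
        -- exists (S p), x, y; auto.
      * intros (i & x & y & Hi & Hx & Hy & ->).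
        destruct (Nat.eq_dec i (S p)) as [->|Hi'].
        -- right. now exists (x, y).
        -- left. exists i, x, y; repeat split; trivial; lia.
    + intros e (i & x & y & Hi & Hx & _ & ->) ([x' y'] & [Hx' _] & E).
      apply Hf in E. destruct E as [-> _].
      apply HA in Hx. apply HA in Hx'. simpl in Hx, Hx'. lia.
Qed.

(** * Sigma-star expressions *)

(* A new leaf [x] is attached to the left or to the right of any of the
   [rsize t] nodes of [t]; this reaches every tree with one more letter exactly
   once, whence [T (k+1) = 2 (2k - 1) T k] for the number of trees. *)
Fixpoint insert_leaf (x : nat) (t : re) : list re :=
  Plus (Lit x) t :: Plus t (Lit x) ::
  match t with
  | Plus a b => map (fun a' => Plus a' b) (insert_leaf x a)
                ++ map (Plus a) (insert_leaf x b)
  | _ => nil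
  end.

(* Left inverse of [insert_leaf]; its values on other trees are irrelevant. *)
Fixpoint delete_leaf (x : nat) (t : re) : re :=
  match t with
  | Plus a b =>
      if Nat.eqb (occ x a) 0 then
        match b with Lit _ => a | _ => Plus a (delete_leaf x b) end
      else
        match a with Lit _ => b | _ => Plus (delete_leaf x a) b end
  | _ => t
  end.

Lemma insert_leaf_Plus (x : nat) (t s : re) :
  In s (insert_leaf x t) -> exists a b, s = Plus a b.
Proof.
  destruct t; simpl; intros H;
    repeat (destruct H as [<-|H]; [eauto|]); try easy.
  apply in_app_or in H. destruct H as [H|H]; apply in_map_iff in H;
    destruct H as (? & <- & _); eauto.
Qed.

Lemma insert_leaf_spec (x : nat) (t s : re) :
  union_of_letters t -> In s (insert_leaf x t) ->
  union_of_letters s /\ rsize s = (rsize t + 2)%nat /\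
  (forall i, occ i s = (occ i (Lit x) + occ i t)%nat) /\
  (forall k, letters_ok k s <-> (x < k)%nat /\ letters_ok k t).
Proof.
  revert s; induction t as [|j|a IHa b IHb|a _ b _|a _]; intros s Ht Hs; try easy.
  - simpl in Hs. destruct Hs as [<-|[<-|[]]]; simpl; repeat split; try lia;
      intros; intuition lia.
  - destruct Ht as [Ha Hb].
    destruct Hs as [<-|[<-|Hs]].
    + simpl; repeat split; try tauto; lia.
    + simpl; repeat split; try tauto; intros; lia.
    + apply in_app_or in Hs. destruct Hs as [Hs|Hs]; apply in_map_iff in Hs;
        destruct Hs as (s' & <- & Hs'); [apply IHa in Hs'|apply IHb in Hs']; trivial;
        destruct Hs' as (H1 & H2 & H3 & H4); simpl; repeat split; trivial;
        try (rewrite H2; lia); try (intros i; rewrite H3; simpl; lia);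
        try (now apply H4); try (now apply H4 in H0); firstorder.
Qed.

(** Deletion follows the only occurrence of [x] down to the node where it was attached. Since [t] is
    recovered from [s], different trees have disjoint insertion lists. *)
Lemma delete_insert_leaf (x : nat) (t s : re) :
  union_of_letters t -> occ x t = 0%nat -> In s (insert_leaf x t) ->
  delete_leaf x s = t.
Proof.
  revert s; induction t as [|j|a IHa b IHb|a _ b _|a _]; intros s Ht Hx Hs; try easy.
  - simpl in Hs, Hx. destruct Hs as [<-|[<-|[]]]; cbn; rewrite ?Nat.eqb_refl; simpl;
      trivial. now rewrite Hx.
  - destruct Ht as [Ha Hb]. simpl in Hx.
    destruct Hs as [<-|[<-|Hs]].
    + cbn. now rewrite Nat.eqb_refl.
    + cbn. now replace (occ x a + occ x b)%nat with 0%nat by lia.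
    + apply in_app_or in Hs. destruct Hs as [Hs|Hs]; apply in_map_iff in Hs;
        destruct Hs as (s' & <- & Hs'); pose proof Hs' as Hs'';
        destruct (insert_leaf_Plus _ _ _ Hs') as (c & d & ->).
      * apply insert_leaf_spec in Hs''; trivial. destruct Hs'' as (_ & _ & Ho & _).
        specialize (Ho x). apply IHa in Hs'; try lia; trivial.
        cbn [delete_leaf]. rewrite Ho. simpl occ at 1. rewrite Nat.eqb_refl.
        simpl Nat.eqb. cbv iota. now f_equal.
      * apply IHb in Hs'; try lia; trivial.
        cbn [delete_leaf]. replace (occ x a) with 0%nat by lia.
        simpl Nat.eqb. cbv iota. now f_equal.
Qed.

(** Surjectivity of insertion: a leaf other than the root has a sibling, and removing the leaf
    leaves that sibling in place of their parent. *)
Lemma delete_leaf_spec (x : nat) (s : re) :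
  union_of_letters s -> occ x s = 1%nat -> s <> Lit x ->
  union_of_letters (delete_leaf x s) /\ In s (insert_leaf x (delete_leaf x s)).
Proof.
  induction s as [|j|a IHa b IHb|a _ b _|a _]; intros Hs Hx Hne; try easy.
  - simpl in Hx. destruct (Nat.eqb_spec x j); [subst; easy|easy].
  - destruct Hs as [Ha Hb]. simpl in Hx. cbn [delete_leaf].
    destruct (Nat.eqb_spec (occ x a) 0) as [E|E].
    + destruct b as [|j|c d|c d|c]; try easy.
      * simpl in Hx. destruct (Nat.eqb_spec x j); [subst j|lia].
        split; trivial. destruct a; simpl; auto.
      * destruct IHb as [IH1 IH2]; trivial; try lia; try easy.
        split; [split; trivial|].
        simpl; right; right. apply in_or_app; right. now apply in_map.
    + assert (Ea : occ x a = 1%nat) by lia.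
      destruct a as [|j|c d|c d|c]; try easy.
      * simpl in Ea. destruct (Nat.eqb_spec x j); [subst j|lia].
        split; trivial. destruct b; simpl; auto.
      * destruct IHa as [IH1 IH2]; trivial; try easy.
        split; [split; trivial|].
        simpl; right; right. apply in_or_app; left.
        apply (in_map (fun a' => Plus a' b)) in IH2. exact IH2.
Qed.

(** Insertion increases the size, so an insertion into [a] changes the left subtree while one into
    [b] keeps it. Insertions at the root are told apart from the others by size and by the absence
    of [x] from [t]. *)
Lemma insert_leaf_NoDup (x : nat) (t : re) :
  union_of_letters t -> occ x t = 0%nat -> NoDup (insert_leaf x t).
Proof.
  induction t as [|j|a IHa b IHb|a _ b _|a _]; intros Ht Hx; try easy.
  - simpl in Hx. destruct (Nat.eqb_spec x j); [easy|].
    repeat constructor; simpl; [|easy].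
    intros [[= E _]|[]]; congruence.
  - destruct Ht as [Ha Hb]. simpl in Hx.
    assert (Hax : occ x a = 0%nat) by lia. assert (Hbx : occ x b = 0%nat) by lia.
    assert (HL : forall y, occ x y = 0%nat -> y <> Lit x).
    { intros y Hy ->. simpl in Hy. now rewrite Nat.eqb_refl in Hy. }
    assert (Hins : forall y z, union_of_letters y -> occ x y = 0%nat ->
              In z (insert_leaf x y) -> z <> y /\ z <> Lit x).
    { intros y z Hy Hyx Hz; split; intros ->.
      - apply insert_leaf_spec in Hz; trivial.
        destruct Hz as (_ & Hz & _). lia.
      - destruct (insert_leaf_Plus _ _ _ Hz) as (? & ? & ?). easy. }
    simpl. constructor; [|constructor].
    + intros [H|H].
      * discriminate.
      * apply in_app_or in H; destruct H as [H|H]; apply in_map_iff in H;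
          destruct H as (z & [= E1 E2] & Hz).
        -- apply (f_equal rsize) in E2. simpl in E2. lia.
        -- now apply (HL a).
    + intros H. apply in_app_or in H; destruct H as [H|H]; apply in_map_iff in H;
          destruct H as (z & [= E1 E2] & Hz).
        * now apply (HL b).
        * apply (f_equal rsize) in E1. simpl in E1. lia.
    + apply NoDup_app.
      * apply Injective_map_NoDup; [now intros ? ? [=]|auto].
      * apply Injective_map_NoDup; [now intros ? ? [=]|auto].
      * intros z Hz Hz'. apply in_map_iff in Hz. destruct Hz as (z1 & <- & Hz).
        apply in_map_iff in Hz'. destruct Hz' as (z2 & [= E1 E2] & Hz').
        destruct (Hins a z1 Ha Hax Hz); congruence.
Qed.

Lemma insert_leaf_length (x : nat) (t : re) :
  union_of_letters t -> length (insert_leaf x t) = (2 * rsize t)%nat.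
Proof.
  induction t as [|j|a IHa b IHb|a _ b _|a _]; intros Ht; try easy.
  destruct Ht as [Ha Hb]. simpl.
  rewrite length_app, !length_map, IHa, IHb by trivial. lia.
Qed.

(** Convertible to [sigma_star k (Star t)]. *)
Definition letter_tree (k : nat) (t : re) : Prop :=
  union_of_letters t /\ letters_ok k t /\ (forall i, (i < k)%nat -> occ i t = 1%nat).

(** The trees on the [m + 1] letters [0, ..., m]: a tree has at least one leaf, so the index is one
    less than the number of letters. *)
Fixpoint letter_trees (m : nat) : list re :=
  match m with
  | O => Lit 0 :: nil
  | S m => flat_map (insert_leaf (S m)) (letter_trees m)
  end.

Lemma occ_letters_ok (k i : nat) (t : re) :
  letters_ok k t -> (k <= i)%nat -> occ i t = 0%nat.
Proof.
  induction t as [|j|a IHa b IHb|a IHa b IHb|a IHa]; simpl; intros Ht Hi; trivial.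
  - destruct (Nat.eqb_spec i j); lia.
  - destruct Ht. rewrite IHa, IHb; trivial.
  - destruct Ht. rewrite IHa, IHb; trivial.
  - auto.
Qed.

Lemma letters_ok_pred (k : nat) (t : re) :
  letters_ok (S k) t -> occ k t = 0%nat -> letters_ok k t.
Proof.
  induction t as [|j|a IHa b IHb|a IHa b IHb|a IHa]; simpl; intros Ht Hi; trivial.
  - destruct (Nat.eqb_spec k j); lia.
  - destruct Ht. split; [apply IHa|apply IHb]; trivial; lia.
  - destruct Ht. split; [apply IHa|apply IHb]; trivial; lia.
  - auto.
Qed.

Lemma letter_trees_spec (m : nat) (t : re) :
  In t (letter_trees m) <-> letter_tree (S m) t.
Proof.
  revert t; induction m as [|m IH]; intros t; split.
  - intros [<-|[]]. repeat split.
    + simpl; lia.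
    + intros i Hi. replace i with 0%nat by lia. reflexivity.
  - intros (H1 & H2 & H3). left.
    destruct t as [|j|a b|a b|a]; try easy.
    + simpl in H2. f_equal; lia.
    + exfalso. specialize (H3 0%nat Nat.lt_0_1).
      (* Over a single letter every union contains that letter, so a [Plus] would contain it at
         least twice. *)
      assert (Hocc : forall t, union_of_letters t -> letters_ok 1 t -> (0 < occ 0 t)%nat).
      { clear. induction t as [|j|a IHa b IHb|a _ b _|a _]; simpl; try easy.
        - intros _ Hj. replace j with 0%nat by lia. simpl; lia.
        - intros [Ha _] [Ha' _]. specialize (IHa Ha Ha'). lia. }
      destruct H1 as [Ha Hb], H2 as [Ha' Hb'].
      specialize (Hocc a Ha Ha') as Ea. specialize (Hocc b Hb Hb') as Eb.
      simpl in H3. lia.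
  - intros Ht. apply in_flat_map in Ht. destruct Ht as (s & Hs & Ht).
    apply IH in Hs. destruct Hs as (H1 & H2 & H3).
    pose proof (occ_letters_ok _ (S m) _ H2 (Nat.le_refl _)) as H4.
    apply insert_leaf_spec in Ht; trivial.
    destruct Ht as (G1 & _ & G3 & G4). split; [trivial|split].
    + apply G4. split; [lia|].
      clear -H2. induction s; simpl in *; try tauto; lia.
    + intros i Hi. rewrite G3. simpl.
      destruct (Nat.eqb_spec i (S m)) as [->|]; [lia|]. rewrite H3; lia.
  - intros (H1 & H2 & H3).
    assert (H4 : occ (S m) t = 1%nat) by (apply H3; lia).
    assert (H5 : t <> Lit (S m)).
    { intros ->. specialize (H3 0%nat ltac:(lia)). discriminate. }
    destruct (delete_leaf_spec _ _ H1 H4 H5) as [G1 G2].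
    apply in_flat_map. exists (delete_leaf (S m) t); split; trivial.
    apply IH. destruct (insert_leaf_spec _ _ _ G1 G2) as (_ & _ & G3 & G4).
    assert (G5 : forall i, (i < S (S m))%nat ->
      occ i (delete_leaf (S m) t) = if Nat.eqb i (S m) then 0%nat else 1%nat).
    { intros i Hi. specialize (G3 i). rewrite H3 in G3 by trivial.
      simpl in G3. destruct (Nat.eqb i (S m)); lia. }
    split; [trivial|split].
    + apply letters_ok_pred; [apply G4, H2|].
      rewrite G5 by lia. now rewrite Nat.eqb_refl.
    + intros i Hi. rewrite G5 by lia. destruct (Nat.eqb_spec i (S m)); [lia|easy].
Qed.

Lemma letter_trees_size (m : nat) (t : re) :
  In t (letter_trees m) -> rsize t = (2 * m + 1)%nat.
Proof.
  revert t; induction m as [|m IH]; intros t Ht.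
  - destruct Ht as [<-|[]]. reflexivity.
  - apply in_flat_map in Ht. destruct Ht as (s & Hs & Ht).
    apply insert_leaf_spec in Ht.
    + destruct Ht as (_ & -> & _). rewrite IH by trivial. lia.
    + apply letter_trees_spec in Hs. apply Hs.
Qed.

Lemma letter_trees_NoDup (m : nat) : NoDup (letter_trees m).
Proof.
  induction m as [|m IH]; [repeat constructor; easy|].
  simpl.
  assert (Hsp : forall s, In s (letter_trees m) ->
            union_of_letters s /\ occ (S m) s = 0%nat).
  { intros s Hs. apply letter_trees_spec in Hs. split; [apply Hs|].
    apply (occ_letters_ok (S m)); [apply Hs|lia]. }
  (* A second induction, along the list of smaller trees; [Hsp] is in the context so that it is
     generalized with the list. *)
  induction IH as [|s l Hs Hl IHl]; simpl; [constructor|].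
  apply NoDup_app.
  - apply insert_leaf_NoDup; apply Hsp; now left.
  - apply IHl. intros; apply Hsp; now right.
  - intros t Ht Ht'. apply in_flat_map in Ht'. destruct Ht' as (s' & Hs' & Ht').
    apply delete_insert_leaf in Ht; [|apply Hsp; now left|apply Hsp; now left].
    apply delete_insert_leaf in Ht'; [|apply Hsp; now right|apply Hsp; now right].
    congruence.
Qed.

Lemma letter_trees_length_S (m : nat) :
  length (letter_trees (S m)) = ((4 * m + 2) * length (letter_trees m))%nat.
Proof.
  simpl letter_trees.
  rewrite (flat_map_constant_length (c := (4 * m + 2)%nat)); [apply Nat.mul_comm|].
  intros s Hs. rewrite insert_leaf_length.
  - rewrite (letter_trees_size m) by trivial. lia.
  - apply letter_trees_spec in Hs. apply Hs.
Qed.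

(** From [(2m+2)(2m+1) = (4m+2)(m+1)]. In this product form it shows that the natural-number
    division in [Ck] is exact. *)
Lemma fact_letter_trees (m : nat) :
  fact (2 * m) = (length (letter_trees m) * fact m)%nat.
Proof.
  induction m as [|m IH]; [reflexivity|].
  rewrite letter_trees_length_S.
  replace (2 * S m)%nat with (S (S (2 * m))) by lia.
  rewrite !fact_simpl, IH. ring.
Qed.

Lemma Ck_letter_trees (m : nat) : Ck (S m) = INR (length (letter_trees m)).
Proof.
  unfold Ck. replace (2 * S m - 2)%nat with (2 * m)%nat by lia.
  replace (S m - 1)%nat with m by lia.
  rewrite fact_letter_trees, Nat.div_mul by apply fact_neq_0. reflexivity.
Qed.

(** The operands of each union inside are literals or unions, never stars, so a Sigma-star
    expression itself lies in the set counted. This permits subtracting their number from the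
    coefficients. *)
Lemma sigma_star_spec (k : nat) (e : re) :
  (1 <= k)%nat -> sigma_star k e ->
  letters_ok k e /\ re_na k e /\ rsize e = (2 * k)%nat.
Proof.
  intros Hk. destruct e as [|j|a b|a b|t]; try easy. intros H.
  destruct k as [|m]; [lia|].
  pose proof (proj2 (letter_trees_spec m t) H) as Hin.
  apply letter_trees_size in Hin.
  destruct H as (H1 & H2 & _). simpl. repeat split; trivial; [|lia].
  clear -H1. induction t as [|j|a IHa b IHb|a _ b _|a _]; try easy.
  destruct H1 as [Ha Hb]. simpl; repeat split; auto.
  - intros H; destruct a; easy.
  - intros H; destruct b; easy.
Qed.

Lemma has_card_sigma_star (k n : nat) :
  (1 <= k)%nat ->
  has_card (fun e => sigma_star k e /\ rsize e = n) (mono (Ck k) (2 * k) n).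
Proof.
  intros Hk. unfold mono. destruct (Nat.eqb_spec n (2 * k)) as [->|Hn].
  - apply (has_card_ext (fun e => exists t, letter_tree k t /\ e = Star t)).
    + intros e; split.
      * intros (t & Ht & ->). split; [exact Ht|].
        now apply (sigma_star_spec k (Star t)).
      * intros [He _]. destruct e as [|j|a b|a b|t]; try easy. now exists t.
    + apply has_card_image; [now intros a b [= ->]|].
      destruct k as [|m]; [lia|]. exists (letter_trees m).
      split; [apply letter_trees_NoDup|split].
      * symmetry; apply Ck_letter_trees.
      * apply letter_trees_spec.
  - apply has_card_empty. intros e [He Hs].
    apply sigma_star_spec in He; trivial. lia.
Qed.

(** * The quadratic equation of the generating function *)

Lemma has_card_atoms (k : nat) :
  has_card (fun e => e = Eps \/ exists i, (i < k)%nat /\ e = Lit i) (INR k + 1).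
Proof.
  rewrite Rplus_comm. apply (has_card_or (fun e => e = Eps)).
  - exists (Eps :: nil); repeat split.
    + repeat constructor; easy.
    + now intros [<-|[]].
    + intros ->; now left.
  - apply has_card_image; [now intros a b [= ->]|].
    exists (seq 0 k); repeat split.
    + apply seq_NoDup.
    + now rewrite length_seq.
    + intros H; apply in_seq in H; lia.
    + intros H; apply in_seq; lia.
  - now intros e -> (i & _ & ?).
Qed.

Lemma fps_equation (k : nat) (a : fps) :
  (1 <= k)%nat ->
  (forall n, has_card (fun e => letters_ok k e /\ re_na k e /\ rsize e = n) (a n)) ->
  (a = mono (INR k + 1) 1 + X * a + X * (a * a)
       + X * ((a - mono (Ck k) (2 * k)) * (a - mono (Ck k) (2 * k))))%fps.
Proof.
  intros Hk Ha.
  set (s := mono (Ck k) (2 * k)).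
  set (A := fun n e => letters_ok k e /\ re_na k e /\ rsize e = n) in Ha.
  (* The expressions allowed as operands of [Plus]; their series is [a - s]. *)
  set (B := fun n e => A n e /\ ~ (sigma_star k e /\ rsize e = n)).
  assert (Hb : forall n, has_card (B n) ((a - s)%fps n)).
  { intros n. apply has_card_minus; [apply Ha|now apply has_card_sigma_star|].
    intros e [He Hs]. split; [|split; trivial]; now apply (sigma_star_spec k e). }
  apply functional_extensionality; intros [|n].
  - apply (has_card_unique (A 0%nat)); [apply Ha|].
    replace (_ 0%nat) with 0.
    + apply has_card_empty. intros e (_ & _ & He). destruct e; simpl in He; lia.
    + unfold fps_add. rewrite !fps_mul_mono. unfold mono; simpl. ring.
  - apply (has_card_unique (A (S n))); [apply Ha|].
    unfold fps_add. rewrite !fps_mul_mono. simpl Nat.leb. cbv iota.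
    replace (S n - 1)%nat with n by lia. rewrite !Rmult_1_l.
    (* The four summands count, in order, atoms, stars, concatenations and unions. The disjointness
       goals hold because the head constructors differ. *)
    eapply has_card_ext; [|apply has_card_or; [apply has_card_or; [apply has_card_or| |]| |]].
    2: { instantiate (1 := fun e => n = 0%nat /\ (e = Eps \/ exists i, (i < k)%nat /\ e = Lit i)).
         unfold mono. destruct n as [|n]; simpl Nat.eqb; cbv iota.
         - eapply has_card_ext; [|apply has_card_atoms]. tauto.
         - apply has_card_empty. now intros e [? _]. }
    2: { apply (has_card_image Star); [now intros ? ? [= ->]|apply Ha]. }
    3: { apply (has_card_conv Cat A A); [now intros ? ? ? ? [= -> ->]| |apply Ha|apply Ha].
         now intros i x (_ & _ & ?). }
    4: { apply (has_card_conv Plus B B); [now intros ? ? ? ? [= -> ->]| |apply Hb|apply Hb].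
         now intros i x ((_ & _ & ?) & _). }
    + intros e; split.
      * intros [[[(-> & [->|(i & Hi & ->)])|(x & Hx & ->)]|(i & x & y & Hi & Hx & Hy & ->)]
               |(i & x & y & Hi & Hx & Hy & ->)].
        -- now repeat split.
        -- now repeat split.
        -- destruct Hx as (? & ? & <-). repeat split; trivial. simpl; lia.
        -- destruct Hx as (? & ? & ?), Hy as (? & ? & ?).
           repeat split; trivial. simpl; lia.
        -- destruct Hx as ((? & ? & ?) & ?), Hy as ((? & ? & ?) & ?).
           repeat split; trivial; [tauto|tauto|simpl; lia].
      * intros (H1 & H2 & H3). destruct e as [|j|x y|x y|x]; simpl in H1, H2, H3.
        -- left; left; left. split; [lia|now left].
        -- left; left; left. split; [lia|right; now exists j].
        -- right. exists (rsize x), x, y. unfold B, A. repeat split; try tauto; lia.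
        -- left; right. exists (rsize x), x, y. unfold A. repeat split; try tauto; lia.
        -- left; left; right. exists x. unfold A. repeat split; try tauto; lia.
    + now intros e [_ [->|(i & _ & ->)]] (x & _ & ?).
    + intros e [[_ [->|(i & _ & ->)]]|(x & _ & ->)] (i' & x' & y' & _ & _ & _ & ?); easy.
    + intros e [[[_ [->|(i & _ & ->)]]|(x & _ & ->)]|(i & x & y & _ & _ & _ & ->)]
        (i' & x' & y' & _ & _ & _ & ?); easy.
Qed.

(** * Wallis' formula and the coefficients of a square root *)

(* [binomial (2n, n) / 4^n] *)
Fixpoint central (n : nat) : R :=
  match n with
  | O => 1
  | S n => central n * ((2 * INR n + 1) / (2 * INR n + 2))
  end.

Lemma central_pos (n : nat) : 0 < central n.
Proof.
  induction n as [|n IH]; simpl central; [lra|].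
  pose proof (pos_INR n). apply Rmult_lt_0_compat; trivial.
  apply Rdiv_lt_0_compat; lra.
Qed.

Definition sin_int (n : nat) : R := RInt (fun x => sin x ^ n) 0 (PI / 2).

Lemma ex_RInt_sin_pow (n : nat) : ex_RInt (fun x => sin x ^ n) 0 (PI / 2).
Proof.
  apply (ex_RInt_continuous (V := R_CompleteNormedModule)); intros x _.
  apply (ex_derive_continuous (V := R_NormedModule)). auto_derive; trivial.
Qed.

Lemma sin_int_0 : sin_int 0 = PI / 2.
Proof.
  unfold sin_int. simpl. rewrite RInt_const. unfold scal; simpl; unfold mult; simpl. lra.
Qed.

Lemma sin_int_1 : sin_int 1 = 1.
Proof.
  unfold sin_int. apply is_RInt_unique.
  replace 1 with (minus (- cos (PI / 2)) (- cos 0))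
    by (rewrite cos_PI2, cos_0; unfold minus, plus, opp; simpl; ring).
  apply (is_RInt_derive (V := R_CompleteNormedModule) (fun x => - cos x)).
  - intros x _. auto_derive; trivial. ring.
  - intros x _. apply (ex_derive_continuous (V := R_NormedModule)). auto_derive; trivial.
Qed.

(** The difference of the two integrands is the derivative of [- cos x * sin x ^ (n+1)], which
    vanishes at both ends of the interval. *)
Lemma sin_int_SS (n : nat) :
  (INR n + 2) * sin_int (S (S n)) = (INR n + 1) * sin_int n.
Proof.
  enough (H : is_RInt (fun x => (INR n + 2) * sin x ^ S (S n) - (INR n + 1) * sin x ^ n)
            0 (PI / 2) 0).
  { pose proof (is_RInt_minus (V := R_NormedModule) _ _ _ _ _ _
      (is_RInt_scal (V := R_NormedModule) _ _ _ (INR n + 2) _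
        (RInt_correct _ _ _ (ex_RInt_sin_pow (S (S n)))))
      (is_RInt_scal (V := R_NormedModule) _ _ _ (INR n + 1) _
        (RInt_correct _ _ _ (ex_RInt_sin_pow n)))) as H'.
    apply (is_RInt_unique (V := R_CompleteNormedModule)) in H.
    apply (is_RInt_unique (V := R_CompleteNormedModule)) in H'.
    unfold scal, minus, plus, opp in H'; simpl in H'; unfold mult in H'; simpl in H'.
    unfold sin_int. simpl. unfold Rminus in H. simpl in H. rewrite H in H'. lra. }
  replace 0 with (minus (- cos (PI / 2) * sin (PI / 2) ^ S n) (- cos 0 * sin 0 ^ S n)) at 2
    by (rewrite cos_PI2, sin_0; unfold minus, plus, opp; simpl; ring).
  apply (is_RInt_derive (V := R_CompleteNormedModule) (fun x => - cos x * sin x ^ S n)).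
  - intros x _. auto_derive; trivial.
    change (Init.Nat.pred (S n)) with n. change (match n with 0%nat => 1 | S _ => INR n + 1 end) with (INR (S n)).
    rewrite S_INR. simpl pow.
    pose proof (sin2_cos2 x) as E. unfold Rsqr in E.
    replace ((INR n + 2) * (sin x * (sin x * sin x ^ n)) - (INR n + 1) * sin x ^ n)
      with (sin x * sin x * sin x ^ n + (INR n + 1) * sin x ^ n * (sin x * sin x - 1)) by ring.
    replace (sin x * sin x - 1) with (- (cos x * cos x)) by lra. ring.
  - intros x _. apply (ex_derive_continuous (V := R_NormedModule)). auto_derive; trivial.
Qed.

Lemma sin_int_decr (n : nat) : sin_int (S n) <= sin_int n.
Proof.
  pose proof PI_RGT_0. apply RInt_le; try apply ex_RInt_sin_pow; [lra|].
  intros x Hx. simpl.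
  assert (0 <= sin x) by (apply sin_ge_0; lra).
  pose proof (SIN_bound x). pose proof (pow_le (sin x) n H0). nra.
Qed.

Lemma sin_int_even (n : nat) : sin_int (2 * n) = PI / 2 * central n.
Proof.
  induction n as [|n IH]; [simpl Nat.mul; rewrite sin_int_0; simpl; lra|].
  replace (2 * S n)%nat with (S (S (2 * n))) by lia.
  pose proof (sin_int_SS (2 * n)) as H. rewrite IH, mult_INR in H.
  change (INR 2) with 2 in H. pose proof (pos_INR n).
  simpl central. apply (Rmult_eq_reg_l (2 * INR n + 2)); [|lra].
  rewrite H. field. lra.
Qed.

Lemma sin_int_odd (n : nat) : sin_int (S (2 * n)) * ((2 * INR n + 1) * central n) = 1.
Proof.
  induction n as [|n IH]; [simpl Nat.mul; rewrite sin_int_1; simpl; lra|].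
  replace (2 * S n)%nat with (S (S (2 * n))) by lia.
  pose proof (sin_int_SS (S (2 * n))) as H. rewrite S_INR, mult_INR in H.
  change (INR 2) with 2 in H. pose proof (pos_INR n).
  etransitivity; [|exact IH]. rewrite S_INR. simpl central.
  replace (sin_int (S (S (S (2 * n))))) with
    ((2 * INR n + 1 + 1) * sin_int (S (2 * n)) / (2 * INR n + 1 + 2))
    by (rewrite <- H; field; lra).
  field. lra.
Qed.

(* Wallis: [sin_int (2n+2) <= sin_int (2n+1) <= sin_int (2n)]. *)
Lemma central_sq_bounds (n : nat) :
  2 / (PI * (2 * INR n + 1)) <= central n ^ 2
    <= 2 * (2 * INR n + 2) / (PI * (2 * INR n + 1) ^ 2).
Proof.
  pose proof (sin_int_decr (2 * n)) as H1.
  pose proof (sin_int_decr (S (2 * n))) as H2.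
  replace (S (S (2 * n))) with (2 * S n)%nat in H2 by lia.
  rewrite sin_int_even in H1, H2. simpl central in H2.
  pose proof (sin_int_odd n) as H3. pose proof (central_pos n) as Hc.
  pose proof (pos_INR n) as Hn. pose proof PI_RGT_0 as Hp.
  set (N := INR n) in *. set (c := central n) in *.
  assert (E : sin_int (S (2 * n)) = / ((2 * N + 1) * c)).
  { apply (Rmult_eq_reg_r ((2 * N + 1) * c)); [rewrite H3; field; lra|].
    apply Rgt_not_eq, Rmult_lt_0_compat; lra. }
  rewrite E in H1, H2.
  split.
  - apply (Rmult_le_compat_r (2 / PI * c)) in H1;
      [|apply Rmult_le_pos; [apply Rlt_le, Rdiv_lt_0_compat|]; lra].
    replace (2 / (PI * (2 * N + 1))) with (/ ((2 * N + 1) * c) * (2 / PI * c))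
      by (field; lra).
    replace (c ^ 2) with (PI / 2 * c * (2 / PI * c)) by (field; lra). exact H1.
  - assert (Hq : 0 <= 2 * (2 * N + 2) / (PI * (2 * N + 1)) * c).
    { apply Rmult_le_pos; [|lra]. apply Rlt_le, Rdiv_lt_0_compat; nra. }
    apply (Rmult_le_compat_r _ _ _ Hq) in H2.
    replace (c ^ 2) with (PI / 2 * (c * ((2 * N + 1) / (2 * N + 2))) *
      (2 * (2 * N + 2) / (PI * (2 * N + 1)) * c)) by (field; lra).
    replace (2 * (2 * N + 2) / (PI * (2 * N + 1) ^ 2)) with
      (/ ((2 * N + 1) * c) * (2 * (2 * N + 2) / (PI * (2 * N + 1)) * c)) by (field; lra).
    exact H2.
Qed.

Lemma is_lim_seq_inv_S : is_lim_seq (fun n => / (INR n + 1)) 0.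
Proof.
  apply (is_lim_seq_ext (fun n => / INR (S n))); [intros n; now rewrite S_INR|].
  apply (is_lim_seq_incr_1 (fun n => / INR n)).
  replace (Finite 0) with (Rbar_inv p_infty) by reflexivity.
  apply is_lim_seq_inv; [apply is_lim_seq_INR|easy].
Qed.

(* Meant for rational functions [g] of [n], written in terms of [t = 1 / (n + 1)]. *)
Lemma is_lim_seq_rational (f : R -> R) (g : nat -> R) (l : R) :
  continuity_pt f 0 -> f 0 = l -> (forall n, f (/ (INR n + 1)) = g n) ->
  is_lim_seq g l.
Proof.
  intros Hf <- Hg. apply (is_lim_seq_ext _ _ _ Hg).
  apply (is_lim_seq_continuous f _ 0 Hf is_lim_seq_inv_S).
Qed.

Lemma central_sq_lim : is_lim_seq (fun n => (INR n + 1) * central n ^ 2) (/ PI).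
Proof.
  pose proof PI_RGT_0 as Hp.
  apply (is_lim_seq_le_le
    (fun n => (INR n + 1) * (2 / (PI * (2 * INR n + 1)))) _
    (fun n => (INR n + 1) * (2 * (2 * INR n + 2) / (PI * (2 * INR n + 1) ^ 2)))).
  - intros n. pose proof (central_sq_bounds n). pose proof (pos_INR n).
    split; apply Rmult_le_compat_l; lra.
  (* With [t = 1 / (n + 1)], [2n + 1] is [(2 - t) / t] and [2n + 2] is [2 / t]. *)
  - apply (is_lim_seq_rational (fun t => 2 / (PI * (2 - t)))).
    + apply derivable_continuous_pt, ex_derive_Reals_0. auto_derive. lra.
    + field. lra.
    + intros n. pose proof (pos_INR n). field. repeat split; lra.
  - apply (is_lim_seq_rational (fun t => 4 / (PI * (2 - t) ^ 2))).
    + apply derivable_continuous_pt, ex_derive_Reals_0. auto_derive.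
      apply Rgt_not_eq. nra.
    + field. lra.
    + intros n. pose proof (pos_INR n). field. repeat split; lra.
Qed.

(* The Taylor coefficients of [sqrt (1 - X)]. *)
Fixpoint sqrt_coef (n : nat) : R :=
  match n with
  | O => 1
  | S n => sqrt_coef n * ((2 * INR n - 1) / (2 * INR n + 2))
  end.

Lemma one_minus_double_neq_0 (n : nat) : 1 - 2 * INR n <> 0.
Proof.
  intros E.
  assert (E' : INR (2 * n) = INR 1) by (rewrite mult_INR; simpl; lra).
  apply INR_eq in E'. lia.
Qed.

Lemma sqrt_coef_central (n : nat) : sqrt_coef n = central n / (1 - 2 * INR n).
Proof.
  induction n as [|n IH]; [simpl; field|].
  simpl sqrt_coef. simpl central. rewrite IH.
  pose proof (one_minus_double_neq_0 n). pose proof (one_minus_double_neq_0 (S n)). rewrite S_INR in *. pose proof (pos_INR n).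
  field. repeat split; lra.
Qed.

(** The product of [sqrt ((n+1) central n ^ 2)], governed by Wallis, and the rational factor
    [(n+1) / (1 - 2n)]. The weight uses [n + 1] so that it is positive from [n = 0] on. *)
Lemma sqrt_coef_asymp :
  is_lim_seq (fun n => sqrt_coef n * ((INR n + 1) * sqrt (INR n + 1))) (- / (2 * sqrt PI)).
Proof.
  pose proof PI_RGT_0 as Hp.
  assert (H1 : is_lim_seq (fun n => sqrt ((INR n + 1) * central n ^ 2)) (sqrt (/ PI))).
  { apply (is_lim_seq_continuous sqrt _ (/ PI)); [|apply central_sq_lim].
    apply continuity_pt_sqrt. apply Rlt_le, Rinv_0_lt_compat, Hp. }
  assert (H2 : is_lim_seq (fun n => (INR n + 1) / (1 - 2 * INR n)) (- / 2)).
  { apply (is_lim_seq_rational (fun t => 1 / (3 * t - 2))).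
    - apply derivable_continuous_pt, ex_derive_Reals_0. auto_derive. lra.
    - field.
    - intros n. pose proof (one_minus_double_neq_0 n).
      pose proof (pos_INR n). field. repeat split; lra. }
  replace (- / (2 * sqrt PI)) with (- / 2 * sqrt (/ PI))
    by (rewrite sqrt_inv; field; apply Rgt_not_eq, sqrt_lt_R0, Hp).
  eapply is_lim_seq_ext; [|apply (is_lim_seq_mult' _ _ _ _ H2 H1)].
  intros n. cbv beta. pose proof (pos_INR n).
  rewrite sqrt_mult_alt, sqrt_pow2 by (try apply Rlt_le, central_pos; lra).
  rewrite sqrt_coef_central. unfold Rdiv. ring.
Qed.

(* [(1 - X) y' = - y / 2] for [y = sqrt (1 - X)], read off coefficientwise. *)
Lemma sqrt_coef_sq : ((sqrt_coef : fps) * sqrt_coef = 1 - X)%fps.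
Proof.
  set (b := sqrt_coef : fps). set (s := (b * b)%fps).
  set (db := (fun n => INR n * b n) : fps).
  (* The product rule [X (b^2)' = 2 (X b') b], with [db] standing for [X b']. *)
  assert (Hdb : forall n, INR n * s n = 2 * (db * b)%fps n).
  { intros n. replace (2 * (db * b)%fps n) with ((db * b + b * db)%fps n).
    - unfold s, fps_add, fps_mul. rewrite scal_sum, <- sum_plus.
      apply sum_eq; intros i Hi. unfold db. rewrite minus_INR by trivial. ring.
    - rewrite (fps_mulC b db). unfold fps_add. ring. }
  (* The differential equation enters as [shift db = db - b / 2]. In the resulting recurrence for
     the square, the factor [n - 1] vanishes at [n = 1], so all coefficients from index 2 on are
     0. *)
  assert (Hs : forall n, (INR n + 1) * s (S n) = (INR n - 1) * s n).
  { intros n. rewrite <- S_INR, Hdb, fps_mul_S.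
    replace (db 0%nat) with 0 by (unfold db; simpl; ring).
    replace (shift db) with ((db + mono (- / 2) 0 * b)%fps).
    - rewrite fps_mulDl, <- fps_mulA. unfold fps_add at 1. rewrite fps_mul_mono.
      simpl Nat.leb. cbv iota. rewrite Nat.sub_0_r. pose proof (Hdb n). fold s. lra.
    - apply functional_extensionality; intros j. unfold fps_add, shift, db.
      rewrite fps_mul_mono. simpl Nat.leb. cbv iota. rewrite Nat.sub_0_r, S_INR.
      unfold b; simpl sqrt_coef. pose proof (pos_INR j). field. lra. }
  apply functional_extensionality; intros n. fold s.
  induction n as [|[|n] IH].
  - unfold s, fps_mul, fps_sub, mono; simpl; ring.
  - specialize (Hs 0%nat). rewrite IH in Hs. revert Hs.
    unfold fps_sub, mono; simpl. lra.
  - specialize (Hs (S n)). rewrite IH in Hs. revert Hs.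
    unfold fps_sub, mono. pose proof (pos_INR (S n)).
    destruct n as [|n]; simpl Nat.eqb; cbv iota; intros Hs.
    + change (INR 1) with 1 in Hs. lra.
    + apply (Rmult_eq_reg_l (INR (S (S n)) + 1)); [|lra]. lra.
Qed.

(** * Transfer *)

Lemma sum_f_R0_dominated (f M : nat -> R) (J n : nat) :
  (J <= n)%nat -> (forall j, (j <= n)%nat -> Rabs (f j) <= M j) ->
  Rabs (sum_f_R0 f n - sum_f_R0 f J) <= sum_f_R0 M n - sum_f_R0 M J.
Proof.
  intros HJ. induction HJ as [|n HJ IH]; intros Hf.
  - rewrite !Rminus_diag, Rabs_R0. lra.
  - simpl. pose proof (Hf (S n) (Nat.le_refl _)) as H1.
    assert (H2 : Rabs (sum_f_R0 f n - sum_f_R0 f J) <= sum_f_R0 M n - sum_f_R0 M J)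
      by (apply IH; intros; apply Hf; lia).
    replace (sum_f_R0 f n + f (S n) - sum_f_R0 f J)
      with ((sum_f_R0 f n - sum_f_R0 f J) + f (S n)) by ring.
    pose proof (Rabs_triang (sum_f_R0 f n - sum_f_R0 f J) (f (S n))). lra.
Qed.

Lemma is_series_sum_f_R0 (u : nat -> R) (l : R) :
  is_series u l <-> is_lim_seq (sum_f_R0 u) l.
Proof.
  split; intros H.
  - apply (is_lim_seq_ext (sum_n u)); [intros n; apply sum_n_Reals|exact H].
  - apply (is_lim_seq_ext _ (sum_n u)) in H; [exact H|].
    intros n; symmetry; apply sum_n_Reals.
Qed.

Lemma ex_series_nonneg_bounded (u : nat -> R) (M : R) :
  (forall n, 0 <= u n) -> (forall N, sum_f_R0 u N <= M) -> ex_series u.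
Proof.
  intros Hu HM.
  destruct (ex_finite_lim_seq_incr (sum_f_R0 u) M) as [l Hl]; trivial.
  - intros n. simpl. specialize (Hu (S n)). lra.
  - exists l. now apply is_series_sum_f_R0.
Qed.

(** Dominated convergence for a triangular array: beyond some [J] the rows and the limit series are
    uniformly small by [M], and the first [J + 1] columns converge one by one. *)
Lemma tannery (F : nat -> nat -> R) (M l : nat -> R) :
  (forall n j, (j <= n)%nat -> Rabs (F n j) <= M j) -> ex_series M ->
  (forall j, is_lim_seq (fun n => F n j) (l j)) ->
  is_lim_seq (fun n => sum_f_R0 (F n) n) (Series l).
Proof.
  intros HF HM Hl.
  assert (HlM : forall j, Rabs (l j) <= M j).
  { intros j. pose proof (is_lim_seq_abs _ _ (Hl j)) as Ha. simpl in Ha.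
    refine (is_lim_seq_le_loc _ _ (Finite _) (Finite _) _ Ha (is_lim_seq_const (M j))).
    exists j. intros n Hn. now apply HF. }
  assert (HM0 : forall j, 0 <= M j)
    by (intros j; eapply Rle_trans; [apply Rabs_pos|apply HlM]).
  assert (Hex : ex_series l).
  { apply (ex_series_le (V := R_CompleteNormedModule) l M); trivial. }
  destruct HM as [m Hm]. pose proof (proj1 (is_series_sum_f_R0 _ _) Hm) as Hm'.
  assert (Hmle : forall n, sum_f_R0 M n <= m).
  { apply (is_lim_seq_incr_compare _ _ Hm'). intros n. simpl. specialize (HM0 (S n)). lra. }
  pose proof (proj1 (is_series_sum_f_R0 _ _) (Series_correct _ Hex)) as HS.
  assert (Htail : forall J, Rabs (Series l - sum_f_R0 l J) <= m - sum_f_R0 M J).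
  { intros J.
    assert (HJ : is_lim_seq (fun n => Rabs (sum_f_R0 l n - sum_f_R0 l J))
                   (Rabs (Series l - sum_f_R0 l J))).
    { apply (is_lim_seq_abs _ (Finite _)).
      apply is_lim_seq_minus'; [exact HS|apply is_lim_seq_const]. }
    refine (is_lim_seq_le_loc _ _ (Finite _) (Finite _) _ HJ (is_lim_seq_const _)).
    exists J. intros n Hn.
    pose proof (sum_f_R0_dominated l M J n Hn (fun j _ => HlM j)).
    specialize (Hmle n). lra. }
  apply is_lim_seq_spec. intros eps. simpl.
  (* One third each for the tail of the row, the difference of the heads, and the tail of the limit
     series. *)
  assert (He : 0 < eps / 3) by (pose proof (cond_pos eps); lra).
  destruct (proj2 (is_lim_seq_spec _ _) Hm' (mkposreal _ He)) as [J HJ].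
  specialize (HJ J (Nat.le_refl _)). simpl in HJ.
  assert (HJ' : m - sum_f_R0 M J < eps / 3).
  { rewrite Rabs_minus_sym in HJ. apply Rabs_lt_between in HJ. lra. }
  assert (Hfin : is_lim_seq (fun n => sum_f_R0 (F n) J) (sum_f_R0 l J)).
  { clear -Hl. induction J as [|J IH]; simpl; [apply Hl|].
    now apply is_lim_seq_plus'. }
  destruct (proj2 (is_lim_seq_spec _ _) Hfin (mkposreal _ He)) as [N HN].
  exists (max N J). intros n Hn. specialize (HN n ltac:(lia)). simpl in HN.
  pose proof (sum_f_R0_dominated (F n) M J n ltac:(lia) (HF n)) as H1.
  specialize (Htail J). specialize (Hmle n).
  apply Rabs_lt_between in HN. apply Rabs_le_between in H1. apply Rabs_le_between in Htail.
  apply Rabs_lt_between. lra.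
Qed.

(** The power [3/2], in a form whose multiplicativity and continuity extend to 0. *)
Definition pow32 (x : R) : R := x * sqrt x.

Lemma pow32_mult (x y : R) : 0 <= x -> pow32 (x * y) = pow32 x * pow32 y.
Proof.
  intros Hx. unfold pow32. rewrite sqrt_mult_alt by trivial. ring.
Qed.

Lemma pow32_le (x y : R) : 0 <= x <= y -> pow32 x <= pow32 y.
Proof.
  intros H. unfold pow32. apply Rmult_le_compat; try lra; [apply sqrt_pos|].
  apply sqrt_le_1; lra.
Qed.

Lemma is_lim_seq_pow32 (u : nat -> R) (l : R) :
  0 <= l -> is_lim_seq u l -> is_lim_seq (fun n => pow32 (u n)) (pow32 l).
Proof.
  intros Hl Hu. apply is_lim_seq_mult'; trivial.
  apply (is_lim_seq_continuous sqrt); trivial. now apply continuity_pt_sqrt.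
Qed.

(** The square of Bernoulli's inequality for [sqrt rho = 1 + d], since [1 + j d] is at least
    [Rmin 1 d * (j + 1)]. *)
Lemma square_le_geometric (rho : R) :
  1 < rho -> exists K, forall j, (INR j + 1) ^ 2 <= K * rho ^ j.
Proof.
  intros Hr. set (d := sqrt rho - 1).
  assert (Hd : 0 < d).
  { unfold d. pose proof (sqrt_lt_1 1 rho ltac:(lra) ltac:(lra) Hr).
    rewrite sqrt_1 in H. lra. }
  assert (Hm : 0 < Rmin 1 d) by (apply Rmin_glb_lt; lra).
  exists (/ Rmin 1 d ^ 2). intros j.
  assert (Hj : Rmin 1 d * (INR j + 1) <= (1 + d) ^ j).
  { pose proof (poly j d Hd). pose proof (pos_INR j).
    pose proof (Rmin_l 1 d). pose proof (Rmin_r 1 d). nra. }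
  assert (Hsq : rho ^ j = ((1 + d) ^ j) ^ 2).
  { rewrite <- pow_mult, Nat.mul_comm, pow_mult. f_equal. unfold d.
    replace (1 + (sqrt rho - 1)) with (sqrt rho) by ring.
    rewrite pow2_sqrt; lra. }
  rewrite Hsq. apply (Rmult_le_reg_l (Rmin 1 d ^ 2)); [now apply pow_lt|].
  rewrite <- Rmult_assoc, Rinv_r, Rmult_1_l by (apply pow_nonzero; lra).
  rewrite <- Rpow_mult_distr. apply pow_incr. split; trivial.
  pose proof (pos_INR j). nra.
Qed.

(** A factor that converges beyond the singularity 1 contributes only its value there. Termwise, the
    weights at [n] and [n - j] have ratio tending to 1; the domination uses the radius [rho > 1]. *)
Lemma conv_transfer (g b : fps) (rho L : R) :
  1 < rho -> ex_series (fun n => Rabs (g n) * rho ^ n) ->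
  is_lim_seq (fun n => b n * pow32 (INR n + 1)) L ->
  is_lim_seq (fun n => (g * b)%fps n * pow32 (INR n + 1)) (L * Series g).
Proof.
  intros Hr Hg Hb.
  destruct (square_le_geometric rho Hr) as [K HK].
  destruct (filterlim_bounded (V := R_NormedModule) _ (ex_intro _ (L : R_NormedModule) Hb)) as [C HC].
  assert (HC0 : 0 <= C) by (eapply Rle_trans; [apply Rabs_pos|apply (HC 0%nat)]).
  rewrite <- Series_scal_l.
  apply (is_lim_seq_ext (fun n => sum_f_R0 (fun j => g j * (b (n - j)%nat * pow32 (INR n + 1))) n)).
  { intros n. unfold fps_mul. rewrite Rmult_comm, scal_sum.
    apply sum_eq; intros i _. ring. }
  apply (tannery _ (fun j => C * K * (Rabs (g j) * rho ^ j))).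
  - intros n j Hj. specialize (HC (n - j)%nat). specialize (HK j).
    change (Rabs (b (n - j)%nat * pow32 (INR (n - j) + 1)) <= C) in HC.
    (* From [n + 1 <= (n - j + 1) (j + 1)]; the power [3/2] of [j + 1] is rounded up to a square,
       which [rho ^ j] absorbs. *)
    assert (Hw : 0 <= pow32 (INR n + 1) <= pow32 (INR (n - j) + 1) * (INR j + 1) ^ 2).
    { pose proof (pos_INR (n - j)). pose proof (pos_INR j).
      pose proof (pos_INR n).
      assert (En : INR n = INR (n - j) + INR j) by (rewrite <- plus_INR; f_equal; lia).
      split.
      - apply Rmult_le_pos; [lra|apply sqrt_pos].
      - eapply Rle_trans; [apply (pow32_le _ ((INR (n - j) + 1) * (INR j + 1))); nra|].
        rewrite pow32_mult by lra.
        apply Rmult_le_compat_l; [apply Rmult_le_pos; [lra|apply sqrt_pos]|].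
        unfold pow32. simpl. rewrite Rmult_1_r. apply Rmult_le_compat_l; [lra|].
        rewrite <- (sqrt_Rsqr (INR j + 1)) at 2 by lra.
        apply sqrt_le_1_alt. unfold Rsqr. nra. }
    rewrite !Rabs_mult in *. rewrite (Rabs_pos_eq (pow32 (INR n + 1))) by apply Hw.
    assert (Hw' : 0 <= pow32 (INR (n - j) + 1)).
    { pose proof (pos_INR (n - j)). apply Rmult_le_pos; [lra|apply sqrt_pos]. }
    rewrite (Rabs_pos_eq _ Hw') in HC.
    pose proof (Rabs_pos (b (n - j)%nat)). pose proof (Rabs_pos (g j)).
    assert (H1 : Rabs (b (n - j)%nat) * pow32 (INR n + 1) <= C * (K * rho ^ j)).
    { eapply Rle_trans; [apply Rmult_le_compat_l; [trivial|apply Hw]|].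
      rewrite <- Rmult_assoc. apply Rmult_le_compat; trivial.
      - now apply Rmult_le_pos.
      - apply pow2_ge_0. }
    replace (C * K * (Rabs (g j) * rho ^ j)) with (Rabs (g j) * (C * (K * rho ^ j))) by ring.
    now apply Rmult_le_compat_l.
  - apply (ex_series_scal_l (K := R_AbsRing) (V := R_NormedModule) (C * K)). exact Hg.
  - intros j. rewrite Rmult_comm.
    apply (is_lim_seq_mult' (fun _ => g j)); [apply is_lim_seq_const|].
    apply (is_lim_seq_incr_n _ j).
    rewrite <- (Rmult_1_r L).
    apply (is_lim_seq_ext (fun n => (b n * pow32 (INR n + 1)) * pow32 ((INR n + 1 + INR j) / (INR n + 1)))).
    + intros n. pose proof (pos_INR n). pose proof (pos_INR j).
      rewrite Rmult_assoc, <- pow32_mult by lra.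
      replace (n + j - j)%nat with n by lia. do 2 f_equal. rewrite plus_INR. field. lra.
    + apply is_lim_seq_mult'; trivial.
      assert (E1 : pow32 1 = 1) by (unfold pow32; rewrite sqrt_1; ring).
      rewrite <- E1 at 1.
      apply is_lim_seq_pow32; [lra|].
      apply (is_lim_seq_rational (fun t => 1 + INR j * t)).
      * apply derivable_continuous_pt, ex_derive_Reals_0. auto_derive; trivial.
      * ring.
      * intros n. pose proof (pos_INR n). field. lra.
Qed.

(** The index pairs with sum at most [N] lie in the square [[0,N] x [0,N]], and all terms are
    nonnegative. *)
Lemma sum_fps_mul_le (a b : fps) (N : nat) :
  (forall n, 0 <= a n) -> (forall n, 0 <= b n) ->
  sum_f_R0 (a * b)%fps N <= sum_f_R0 a N * sum_f_R0 b N.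
Proof.
  revert a; induction N as [|N IH]; intros a Ha Hb.
  - unfold fps_mul; simpl. lra.
  - rewrite (decomp_sum (a * b)%fps), (decomp_sum a) by lia. simpl Init.Nat.pred.
    rewrite (sum_eq _ (fun i => b (S i) * a 0%nat + (shift a * b)%fps i))
      by (intros i _; rewrite fps_mul_S; ring).
    rewrite sum_plus, <- scal_sum.
    pose proof (IH (shift a) (fun n => Ha (S n)) Hb) as H1.
    assert (H2 : 0 <= sum_f_R0 (shift a) N) by (apply cond_pos_sum; intros; apply Ha).
    change (sum_f_R0 (fun i => a (S i)) N) with (sum_f_R0 (shift a) N).
    replace (sum_f_R0 b (S N)) with (b 0%nat + sum_f_R0 (fun i => b (S i)) N)
      by (symmetry; apply (decomp_sum b); lia).
    replace (b 0%nat + sum_f_R0 (fun i => b (S i)) N) with (sum_f_R0 b N + b (S N))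
      by (symmetry; rewrite <- tech5; symmetry; apply (decomp_sum b (S N)); lia).
    assert (H3 : (a * b)%fps 0%nat + a 0%nat * sum_f_R0 (fun i => b (S i)) N
       = a 0%nat * (sum_f_R0 b N + b (S N))).
    { rewrite <- tech5, (decomp_sum b (S N)) by lia. unfold fps_mul; simpl. ring. }
    specialize (Hb (S N)). nra.
Qed.

(* Writing [g = 1 + v], [2 v = (q - 1) - v^2], so the partial sums [P N] of the
   absolute series of [v] at [x] obey [2 P (N+1) <= 1 + (P N)^2]. *)
Lemma fps_sqrt_bound (g q : fps) (x : R) :
  0 <= x -> g 0%nat = 1 -> (g * g = q)%fps ->
  (forall N, sum_f_R0 (fun n => Rabs (q (S n)) * x ^ S n) N <= 1) ->
  forall N, sum_f_R0 (fun n => Rabs (g (S n)) * x ^ S n) N <= 1.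
Proof.
  intros Hx Hg0 <- Hq.
  set (V := (fun n => Rabs (g (S n)) * x ^ S n) : fps).
  assert (HV : forall n, 0 <= V n)
    by (intros n; apply Rmult_le_pos; [apply Rabs_pos|now apply pow_le]).
  assert (H0 : 2 * V 0%nat = Rabs ((g * g)%fps 1%nat) * x ^ 1).
  { unfold V, fps_mul. simpl. rewrite Hg0.
    replace (1 * g 1%nat + g 1%nat * 1) with (2 * g 1%nat) by ring.
    rewrite Rabs_mult, (Rabs_pos_eq 2) by lra. ring. }
  (* [V n] belongs to the coefficient of index [n + 1], so [V * V] at [n] bounds the part of [g * g]
     at [n + 2] that avoids the constant term of [g]. *)
  assert (HS : forall n, 2 * V (S n) <= Rabs ((g * g)%fps (S (S n))) * x ^ S (S n)
                                        + (V * V)%fps n).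
  { intros n.
    assert (E : (g * g)%fps (S (S n)) = 2 * g (S (S n)) + (shift g * shift g)%fps n).
    { rewrite fps_mul_S, fps_mul_S_r, Hg0. unfold shift at 3. ring. }
    assert (E' : Rabs ((shift g * shift g)%fps n) * x ^ S (S n) <= (V * V)%fps n).
    { unfold fps_mul. eapply Rle_trans.
      - apply Rmult_le_compat_r; [now apply pow_le|apply Rsum_abs].
      - rewrite Rmult_comm, scal_sum. apply sum_Rle; intros i Hi.
        rewrite Rabs_mult. unfold V, shift.
        replace (x ^ S (S n)) with (x ^ S i * x ^ S (n - i))
          by (rewrite <- pow_add; f_equal; lia).
        apply Req_le. ring. }
    eapply Rle_trans; [|apply Rplus_le_compat_l, E'].
    rewrite <- Rmult_plus_distr_r. unfold V. rewrite <- Rmult_assoc.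
    apply Rmult_le_compat_r; [now apply pow_le|].
    rewrite E. rewrite <- (Rabs_pos_eq 2) by lra. rewrite <- Rabs_mult.
    rewrite (Rabs_pos_eq 2) by lra.
    replace (2 * g (S (S n))) with
      ((2 * g (S (S n)) + (shift g * shift g)%fps n) - (shift g * shift g)%fps n) at 1 by ring.
    eapply Rle_trans; [apply Rabs_triang|]. rewrite Rabs_Ropp. apply Rle_refl. }
  assert (Hrec : forall N, 2 * sum_f_R0 V (S N) <=
            sum_f_R0 (fun n => Rabs ((g * g)%fps (S n)) * x ^ S n) (S N)
            + sum_f_R0 (V * V)%fps N).
  { induction N as [|N IH].
    - simpl sum_f_R0 at 1 2. specialize (HS 0%nat). simpl sum_f_R0. lra.
    - rewrite (tech5 V), (tech5 _ (S N)), (tech5 (V * V)%fps). specialize (HS (S N)). lra. }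
  (* The bound 1 reproduces itself: [P <= 1] gives [1 + P^2 <= 2]. *)
  intros N. change (sum_f_R0 V N <= 1). induction N as [|N IH].
  - specialize (Hq 0%nat). simpl sum_f_R0 in *. lra.
  - specialize (Hrec N). specialize (Hq (S N)).
    pose proof (sum_fps_mul_le V V N HV HV).
    pose proof (cond_pos_sum V N HV). nra.
Qed.

(** * Asymptotics of the coefficients *)

(** Completing the square: the two sides differ by [-8 Z] times [a - r], where [r] is the right-hand
    side of the equation. The series are arbitrary so that the rescaled equation is covered;
    numerals are sums of 1 because the ring of series has no others. *)
Lemma discriminant_square (a s P Z : fps) :
  (a = P + Z * a + Z * (a * a) + Z * ((a - s) * (a - s)))%fps ->
  let D := (1 - Z + (1 + 1) * Z * s - (1 + 1) * (1 + 1) * Z * a)%fps in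
  (D * D = (1 - Z) * (1 - Z) - (1 + 1) * (1 + 1) * (1 + 1) * Z * P
           + (1 + 1) * (1 + 1) * Z * s * (1 - Z - Z * s))%fps.
Proof.
  intros H D.
  set (r := (P + Z * a + Z * (a * a) + Z * ((a - s) * (a - s)))%fps) in H.
  transitivity ((1 - Z) * (1 - Z) - (1 + 1) * (1 + 1) * (1 + 1) * Z * P
           + (1 + 1) * (1 + 1) * Z * s * (1 - Z - Z * s)
           - (1 + 1) * (1 + 1) * (1 + 1) * Z * (a - r))%fps.
  - unfold D, r. ring.
  - rewrite <- H. ring.
Qed.

(** The boundary case [m = N + 1], of value 0, occurs for the step at [4k + 2] when [N = 4k + 1]. *)
Lemma sum_step (c : R) (m N : nat) :
  (m <= S N)%nat ->
  sum_f_R0 (fun n => if Nat.leb m n then c else 0) N = c * (INR N + 1 - INR m).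
Proof.
  intros Hm. induction N as [|N IH].
  - destruct m as [|[|m]]; simpl; try ring; lia.
  - rewrite tech5. destruct (Nat.eq_dec m (S (S N))) as [->|Hm'].
    + rewrite sum_eq_R0.
      * destruct (Nat.leb_spec (S (S N)) (S N)); [lia|]. rewrite !S_INR. ring.
      * intros n Hn. destruct (Nat.leb_spec (S (S N)) n); [lia|easy].
    + rewrite IH by lia. destruct (Nat.leb_spec m (S N)); [|lia]. rewrite S_INR. ring.
Qed.

Lemma letter_trees_length_le (m : nat) :
  INR (length (letter_trees m)) <= (4 * INR m + 2) ^ m.
Proof.
  induction m as [|m IH]; [simpl; lra|].
  rewrite letter_trees_length_S, mult_INR, plus_INR, mult_INR, (S_INR m).
  change (INR 4) with (1 + 1 + 1 + 1). change (INR 2) with (1 + 1).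
  pose proof (pos_INR m). rewrite <- tech_pow_Rmult.
  apply Rmult_le_compat; [lra|apply pos_INR|lra|].
  eapply Rle_trans; [exact IH|]. apply pow_incr. lra.
Qed.

(** With [k = m + 1], [C_k <= (4m+2)^m] while [eta^2 < 1 / (8m+16)], so [C_k eta^(2m) <= (1/2)^m].
    This is at most [1/2] because [k >= 2]. *)
Lemma Ck_pow_le (k : nat) (eta : R) :
  (2 <= k)%nat -> 0 < eta -> eta ^ 2 * (8 + 8 * INR k) < 1 ->
  0 <= Ck k * eta ^ (2 * k) * eta <= eta ^ 3 / 2.
Proof.
  intros Hk He He2. destruct k as [|m]; [lia|].
  rewrite Ck_letter_trees. rewrite S_INR in He2.
  pose proof (letter_trees_length_le m) as HC. pose proof (pos_INR m) as Hm.
  set (C := INR (length (letter_trees m))) in *.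
  assert (HC0 : 0 <= C) by apply pos_INR.
  replace (2 * S m)%nat with (2 * m + 2)%nat by lia. rewrite pow_add, pow_mult.
  assert (Hp : 0 <= (eta ^ 2) ^ m) by (apply pow_le, pow_le; lra).
  split.
  - repeat apply Rmult_le_pos; trivial; try lra; apply pow_le; lra.
  - assert (H1 : C * (eta ^ 2) ^ m <= / 2).
    { eapply Rle_trans; [apply Rmult_le_compat_r; [trivial|exact HC]|].
      rewrite <- Rpow_mult_distr. apply Rle_trans with ((/ 2) ^ m).
      - apply pow_incr. pose proof (pow2_ge_0 eta). split; nra.
      - destruct m as [|m]; [lia|]. simpl.
        assert ((/ 2) ^ m <= 1 ^ m) by (apply pow_incr; lra).
        rewrite pow1 in H. lra. }
    assert (H2 : 0 <= eta ^ 3) by (apply pow_le; lra). nra.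
Qed.

(** The factor [z] makes each term an exponent times the corresponding monomial of [Delta_k], the
    shape in which the sum of [Q] produces it. *)
Lemma Derive_Deltak (k : nat) (z : R) :
  let w := Ck k * z ^ (2 * k) * z in
  z * Derive (Deltak k) z = - 2 * z - 2 * (7 + 8 * INR k) * z ^ 2
    + (2 * INR k + 1) * (4 * w) + (2 * INR k + 2) * (- 4 * z * w)
    + (4 * INR k + 2) * (- 4 * w ^ 2).
Proof.
  intros w.
  assert (H : is_derive (Deltak k) z
    (- 2 - 2 * (7 + 8 * INR k) * z
     + 4 * Ck k * ((2 * INR k + 1) * z ^ (2 * k)) * (1 - z - w)
     + 4 * w * (- 1 - Ck k * ((2 * INR k + 1) * z ^ (2 * k))))).
  { unfold Deltak, pk, hk.
    auto_derive; trivial.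
    change (k + (k + 0))%nat with (2 * k)%nat.
    replace (Init.Nat.pred (2 * k + 1)) with (2 * k)%nat by lia.
    rewrite !(pow_add _ (2 * k) 1), plus_INR, mult_INR.
    change (INR 2) with 2. change (INR 1) with 1. unfold w. ring. }
  rewrite (is_derive_unique _ _ _ H). unfold w. ring.
Qed.

(** * The discriminant rescaled to have its root at 1, and its square root *)

Section Asymptotics.

Variables (k : nat) (a : fps) (eta : R).
Hypothesis Hk : (2 <= k)%nat.
Hypothesis Ha : (a = mono (INR k + 1) 1 + X * a + X * (a * a)
       + X * ((a - mono (Ck k) (2 * k)) * (a - mono (Ck k) (2 * k))))%fps.
Hypothesis Heta0 : 0 < eta.
Hypothesis Heta1 : eta < 1 / sqrt (8 + 8 * INR k).
Hypothesis Hroot : Deltak k eta = 0.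

Let w := Ck k * eta ^ (2 * k) * eta.

Lemma eta_sq : eta ^ 2 * (8 + 8 * INR k) < 1.
Proof.
  pose proof (pos_INR k) as H.
  assert (Hs : 0 < sqrt (8 + 8 * INR k)) by (apply sqrt_lt_R0; lra).
  assert (H1 : eta * sqrt (8 + 8 * INR k) < 1).
  { apply (Rmult_lt_compat_r _ _ _ Hs) in Heta1.
    replace (1 / sqrt (8 + 8 * INR k) * sqrt (8 + 8 * INR k)) with 1 in Heta1
      by (field; lra). exact Heta1. }
  rewrite <- (pow2_sqrt (8 + 8 * INR k)) by lra. rewrite <- Rpow_mult_distr.
  assert (H2 : 0 < eta * sqrt (8 + 8 * INR k)) by now apply Rmult_lt_0_compat.
  simpl. nra.
Qed.

Lemma two_le_k : 2 <= INR k.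
Proof. apply (le_INR 2), Hk. Qed.

Lemma eta_lt : eta < / 4.
Proof.
  pose proof eta_sq. pose proof two_le_k.
  destruct (Rlt_le_dec eta (/ 4)) as [|H1]; trivial. nra.
Qed.

(** The second bound is exactly what [theta < 1] requires. It follows from [w <= eta^3 / 2] and
    [6 k eta^2 < 1]. *)
Lemma w_bounds : 0 <= w /\ 12 * INR k * w < eta.
Proof.
  pose proof eta_sq as H1. pose proof two_le_k as H2.
  pose proof (Ck_pow_le k eta Hk Heta0 H1) as [H3 H4]. fold w in H3, H4.
  split; trivial.
  assert (H5 : 12 * INR k * w <= 12 * INR k * (eta ^ 3 / 2))
    by (apply Rmult_le_compat_l; lra).
  assert (H6 : 6 * INR k * eta ^ 2 < 1) by (pose proof (pow2_ge_0 eta); nra).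
  replace (12 * INR k * (eta ^ 3 / 2)) with (6 * INR k * eta ^ 2 * eta) in H5 by field.
  nra.
Qed.

Lemma root_eq :
  1 - 2 * eta - (7 + 8 * INR k) * eta ^ 2 + 4 * w - 4 * eta * w - 4 * w ^ 2 = 0.
Proof.
  rewrite <- Hroot. unfold Deltak, pk, hk, w. rewrite !(pow_add _ (2 * k) 1). ring.
Qed.

(* In terms of the rescaled variable [y = z / eta]: [D] is [sqrt Delta], [G] is
   [D / sqrt (1 - y)] and [Q] is the polynomial [Delta / (1 - y)]. *)
Let D : fps := (1 - mono eta 1 + (1 + 1) * mono eta 1 * mono (Ck k * eta ^ (2 * k)) (2 * k)
            - (1 + 1) * (1 + 1) * mono eta 1 * scale eta a)%fps.

Let Delta : fps := (1 + mono (- 2 * eta) 1 + mono (- (7 + 8 * INR k) * eta ^ 2) 2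
   + mono (4 * w) (2 * k + 1) + mono (- 4 * eta * w) (2 * k + 2)
   + mono (- 4 * w ^ 2) (4 * k + 2))%fps.

Lemma D_square : (D * D = Delta)%fps.
Proof.
  unfold D. rewrite (discriminant_square _ _ (mono ((INR k + 1) * eta) 1)).
  - unfold Delta.
    set (Z := mono eta 1). set (s := mono (Ck k * eta ^ (2 * k)) (2 * k)).
    replace (mono (- 2 * eta) 1) with (- ((1 + 1) * Z))%fps
      by (unfold Z; rewrite mono_add, mono_mul, mono_opp; f_equal; ring).
    (* [7 + 8k] arises as [8 (k + 1) - 1]: the atoms contribute [-8 (k + 1)], the square of [1 - Z]
       contributes 1. *)
    replace (mono (- (7 + 8 * INR k) * eta ^ 2) 2) with
      (Z * Z - (1 + 1) * (1 + 1) * (1 + 1) * Z * mono ((INR k + 1) * eta) 1)%fps.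
    2: { unfold Z. rewrite !mono_add, !mono_mul. simpl Nat.add.
         replace (mono (eta * eta) 2 - mono ((1 + 1) * (1 + 1) * (1 + 1) * eta * ((INR k + 1) * eta)) 2)%fps
         with (mono (eta * eta) 2 + - mono ((1 + 1) * (1 + 1) * (1 + 1) * eta * ((INR k + 1) * eta)) 2)%fps by ring.
         rewrite mono_opp, mono_add. f_equal. ring. }
    replace (mono (4 * w) (2 * k + 1)) with ((1 + 1) * (1 + 1) * Z * s)%fps.
    2: { unfold Z, s, w. rewrite !mono_add, !mono_mul. f_equal; [ring|lia]. }
    replace (mono (- 4 * eta * w) (2 * k + 2)) with (- ((1 + 1) * (1 + 1) * Z * s * Z))%fps.
    2: { unfold Z, s, w. rewrite !mono_add, !mono_mul, mono_opp. f_equal; [ring|lia]. }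
    replace (mono (- 4 * w ^ 2) (4 * k + 2)) with (- ((1 + 1) * (1 + 1) * Z * s * Z * s))%fps.
    2: { unfold Z, s, w. rewrite !mono_add, !mono_mul, mono_opp. f_equal; [ring|lia]. }
    ring.
  - rewrite Ha at 1.
    rewrite !scale_add, !scale_mul, !scale_sub, !scale_mono, pow_1, Rmult_1_l.
    reflexivity.
Qed.

Let b : fps := sqrt_coef.
Let G : fps := (D * b * geom)%fps.
Let Q : fps := (Delta * geom)%fps.

(** Since [b * b = 1 - X], the series [b * geom] is the inverse of [b], so no general inversion of
    series is required. *)
Lemma G_mul_b : (G * b = D)%fps.
Proof.
  transitivity (D * (geom * (b * b)))%fps; [unfold G; ring|].
  unfold b. rewrite sqrt_coef_sq, geom_inv. ring.
Qed.

Lemma G_square : (G * G = Q)%fps.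
Proof.
  transitivity ((D * D) * (geom * (b * b)) * geom)%fps; [unfold G; ring|].
  unfold b. rewrite sqrt_coef_sq, geom_inv, D_square. unfold Q. ring.
Qed.

Lemma G_0 : G 0%nat = 1.
Proof.
  unfold G, D, b, geom, fps_add, fps_sub, fps_mul, mono. simpl. ring.
Qed.

Lemma Q_eq (n : nat) :
  Q n = (if Nat.leb 0 n then 1 else 0) + (if Nat.leb 1 n then - 2 * eta else 0)
    + (if Nat.leb 2 n then - (7 + 8 * INR k) * eta ^ 2 else 0)
    + (if Nat.leb (2 * k + 1) n then 4 * w else 0)
    + (if Nat.leb (2 * k + 2) n then - 4 * eta * w else 0)
    + (if Nat.leb (4 * k + 2) n then - 4 * w ^ 2 else 0).
Proof.
  unfold Q, Delta. rewrite !fps_mulDl. unfold fps_add. now rewrite !mono_mul_geom.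
Qed.

Lemma Q_0 : Q 0%nat = 1.
Proof.
  rewrite Q_eq. simpl Nat.leb at 1 2 3. cbv iota.
  destruct (Nat.leb_spec (2 * k + 1) 0); [lia|].
  destruct (Nat.leb_spec (2 * k + 2) 0); [lia|].
  destruct (Nat.leb_spec (4 * k + 2) 0); [lia|]. ring.
Qed.

Lemma Q_1 : Q 1%nat = 1 - 2 * eta.
Proof.
  rewrite Q_eq. simpl Nat.leb at 1 2 3. cbv iota.
  destruct (Nat.leb_spec (2 * k + 1) 1); [lia|].
  destruct (Nat.leb_spec (2 * k + 2) 1); [lia|].
  destruct (Nat.leb_spec (4 * k + 2) 1); [lia|]. ring.
Qed.

(** By [root_eq] the first three terms add up to [-4w + 4 eta w + 4 w^2], and the later steps cancel
    these one after the other. The constant 6 is generous. *)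
Lemma Q_bound (n : nat) : (2 <= n)%nat -> Rabs (Q n) <= 6 * w.
Proof.
  intros Hn. rewrite Q_eq. pose proof root_eq. pose proof w_bounds as [H0 H1].
  pose proof eta_lt. pose proof two_le_k.
  assert (w < / 96) by nra.
  destruct (Nat.leb_spec 0 n); [|lia]. destruct (Nat.leb_spec 1 n); [|lia].
  destruct (Nat.leb_spec 2 n); [|lia].
  apply Rabs_le.
  destruct (Nat.leb_spec (2 * k + 1) n); destruct (Nat.leb_spec (2 * k + 2) n);
  destruct (Nat.leb_spec (4 * k + 2) n); try lia; split; nra.
Qed.

Lemma Q_vanish (n : nat) : (4 * k + 2 <= n)%nat -> Q n = 0.
Proof.
  intros Hn. rewrite Q_eq. pose proof root_eq.
  destruct (Nat.leb_spec 0 n); [|lia]. destruct (Nat.leb_spec 1 n); [|lia].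
  destruct (Nat.leb_spec 2 n); [|lia].
  destruct (Nat.leb_spec (2 * k + 1) n); [|lia].
  destruct (Nat.leb_spec (2 * k + 2) n); [|lia].
  destruct (Nat.leb_spec (4 * k + 2) n); [|lia]. lra.
Qed.

(** The coefficient in degree 1, plus [6 w] for each of the [4k] degrees from 2 to [4k + 1]. *)
Let theta := 1 - 2 * eta + INR (4 * k) * (6 * w).

Lemma theta_bounds : 0 < theta < 1.
Proof.
  unfold theta. rewrite mult_INR. change (INR 4) with (1 + 1 + 1 + 1).
  pose proof w_bounds as [H0 H1]. pose proof eta_lt. pose proof two_le_k. nra.
Qed.

Lemma sum_Q_le (N : nat) : sum_f_R0 (fun n => Rabs (Q (S n))) N <= theta.
Proof.
  pose proof w_bounds as [H0 H1]. pose proof eta_lt as H2.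
  assert (H : sum_f_R0 (fun n => Rabs (Q (S n))) N
    <= 1 - 2 * eta + INR (min N (4 * k)) * (6 * w)).
  { induction N as [|N IH].
    - simpl sum_f_R0. rewrite Q_1, Rabs_pos_eq by lra. simpl. lra.
    - rewrite tech5. destruct (Nat.le_gt_cases (4 * k) N) as [HN|HN].
      + rewrite Q_vanish, Rabs_R0 by lia.
        rewrite Nat.min_r in * by lia. lra.
      + rewrite Nat.min_l in * by lia. rewrite S_INR.
        pose proof (Q_bound (S (S N)) ltac:(lia)). lra. }
  eapply Rle_trans; [exact H|]. unfold theta.
  apply Rplus_le_compat_l, Rmult_le_compat_r; [lra|]. apply le_INR. lia.
Qed.

(** [Q] has degree at most [4k + 1], so with [x = theta^(-1/(4k+1))] every weight is at most
    [1 / theta]. *)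
Lemma sum_Q_geometric_le :
  exists x, 1 < x /\ forall N, sum_f_R0 (fun n => Rabs (Q (S n)) * x ^ S n) N <= 1.
Proof.
  pose proof theta_bounds as [H0 H1].
  assert (Hd : 0 < INR (4 * k + 1)) by (apply lt_0_INR; lia).
  set (x := Rpower (/ theta) (/ INR (4 * k + 1))).
  assert (Hx : x ^ (4 * k + 1) = / theta).
  { unfold x. rewrite <- Rpower_pow by apply exp_pos.
    rewrite Rpower_mult, Rinv_l, Rpower_1; [trivial|now apply Rinv_0_lt_compat|lra]. }
  assert (Hx1 : 1 < x).
  { unfold x. rewrite <- (Rpower_O (/ theta)) by now apply Rinv_0_lt_compat.
    apply Rpower_lt; [|now apply Rinv_0_lt_compat].
    rewrite <- Rinv_1. apply Rinv_lt_contravar; lra. }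
  exists x. split; trivial. intros N.
  apply Rle_trans with (sum_f_R0 (fun n => Rabs (Q (S n)) * / theta) N).
  - apply sum_Rle. intros n _. destruct (Nat.le_gt_cases (4 * k + 2) (S n)).
    + rewrite Q_vanish, Rabs_R0 by trivial. lra.
    + apply Rmult_le_compat_l; [apply Rabs_pos|]. rewrite <- Hx.
      apply Rle_pow; [lra|lia].
  - rewrite <- scal_sum. pose proof (sum_Q_le N).
    apply (Rmult_le_reg_l theta); trivial. rewrite <- Rmult_assoc, Rinv_r by lra. lra.
Qed.

Lemma G_bound :
  exists x, 1 < x /\ forall N, sum_f_R0 (fun n => Rabs (G (S n)) * x ^ S n) N <= 1.
Proof.
  destruct sum_Q_geometric_le as (x & Hx & H). exists x. split; trivial.
  apply (fps_sqrt_bound G Q); [lra|apply G_0|apply G_square|exact H].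
Qed.

Lemma G_ex_series :
  exists x, 1 < x /\ ex_series (fun n => Rabs (G n) * x ^ n).
Proof.
  destruct G_bound as (x & Hx & H). exists x. split; trivial.
  apply ex_series_incr_1. apply (ex_series_nonneg_bounded _ 1); [|exact H].
  intros n. apply Rmult_le_pos; [apply Rabs_pos|apply pow_le; lra].
Qed.

Lemma G_ex_series_abs : ex_series (fun n => Rabs (G n)).
Proof.
  destruct G_ex_series as (x & Hx & H).
  apply (ex_series_le (V := R_CompleteNormedModule) _ (fun n => Rabs (G n) * x ^ n)); trivial.
  intros n. unfold norm; simpl. unfold abs; simpl. rewrite Rabs_Rabsolu.
  pose proof (Rabs_pos (G n)). pose proof (pow_R1_Rle x n ltac:(lra)). nra.
Qed.

(** If [d_j] are the coefficients of [Delta], the sum of [Q] up to [N >= 4k + 1] is that of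
    [(N + 1 - j) d_j]. The part with [N + 1] vanishes at the root, and the sum of [- j d_j] is
    [- eta * Delta_k'(eta)]. *)
Lemma Q_series : is_series Q (psik k eta).
Proof.
  apply is_series_sum_f_R0.
  apply (is_lim_seq_ext_loc (fun _ => psik k eta)); [|apply is_lim_seq_const].
  exists (4 * k + 1)%nat. intros N HN.
  rewrite (sum_eq _ _ _ (fun n _ => Q_eq n)), !sum_plus, !sum_step by lia.
  unfold psik. replace (- eta * Derive (Deltak k) eta) with
    (- (eta * Derive (Deltak k) eta)) by ring.
  rewrite Derive_Deltak. fold w. rewrite !plus_INR, !mult_INR.
  change (INR 4) with (1 + 1 + 1 + 1). change (INR 2) with (1 + 1).
  change (INR 1) with 1. change (INR 0) with 0.
  pose proof root_eq as E.
  transitivity (- (eta * 0) + (INR N + 1) * (1 - 2 * eta - (7 + 8 * INR k) * eta ^ 2 + 4 * w - 4 * eta * w - 4 * w ^ 2)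
   - (- 2 * eta - 2 * (7 + 8 * INR k) * eta ^ 2
    + (2 * INR k + 1) * (4 * w) + (2 * INR k + 2) * (- 4 * eta * w)
    + (4 * INR k + 2) * (- 4 * w ^ 2))); [rewrite E|]; ring.
Qed.

(** The constant term 1 of [Q] outweighs the others, whose absolute sum is at most [theta < 1]; in
    particular the root is simple. *)
Lemma psik_pos : 0 < psik k eta.
Proof.
  apply Rlt_le_trans with (1 - theta); [pose proof theta_bounds; lra|].
  pose proof (proj1 (is_series_sum_f_R0 _ _) Q_series) as H.
  apply is_lim_seq_incr_1 in H.
  refine (is_lim_seq_le _ _ (Finite _) (Finite _) _ (is_lim_seq_const _) H).
  intros N. rewrite decomp_sum, Q_0 by lia. simpl Init.Nat.pred.
  pose proof (sum_Q_le N) as H1.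
  pose proof (Rsum_abs (fun n => Q (S n)) N) as H2.
  apply (Rle_trans _ _ _ H2), Rabs_le_between in H1. lra.
Qed.

(** The Cauchy product gives the square of the sum. Its sign is decided by [G_bound]: the terms
    after the initial 1 have absolute sum at most 1. *)
Lemma G_series : Series G = sqrt (psik k eta).
Proof.
  pose proof G_ex_series_abs as Habs.
  pose proof (Series_correct _ (ex_series_Rabs _ Habs)) as HG.
  symmetry. apply sqrt_lem_1.
  - apply Rlt_le, psik_pos.
  - destruct G_bound as (x & Hx & Hb).
    apply is_series_sum_f_R0, is_lim_seq_incr_1 in HG.
    refine (is_lim_seq_le _ _ (Finite _) (Finite _) _ (is_lim_seq_const _) HG).
    intros N. rewrite decomp_sum, G_0 by lia. simpl Init.Nat.pred.
    specialize (Hb N).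
    assert (H2 : Rabs (sum_f_R0 (fun n => G (S n)) N) <= 1).
    { eapply Rle_trans; [apply Rsum_abs|]. eapply Rle_trans; [|exact Hb].
      apply sum_Rle. intros n _.
      pose proof (Rabs_pos (G (S n))). pose proof (pow_R1_Rle x (S n) ltac:(lra)). nra. }
    apply Rabs_le_between in H2. lra.
  - pose proof (is_series_mult _ _ _ _ HG HG Habs Habs) as H.
    change (is_series (G * G)%fps (Series G * Series G)) in H.
    rewrite G_square in H.
    rewrite <- (is_series_unique _ _ H). apply is_series_unique, Q_series.
Qed.

Lemma D_asymp :
  is_lim_seq (fun n => D n * pow32 (INR n + 1)) (- / (2 * sqrt PI) * sqrt (psik k eta)).
Proof.
  destruct G_ex_series as (x & Hx & H).
  rewrite <- G_series, <- G_mul_b.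
  apply (conv_transfer G b x); trivial. apply sqrt_coef_asymp.
Qed.

(** The polynomial part of [D] has degree at most [2k + 1], and the factor [X] in front of [a]
    shifts the index by one. *)
Lemma D_coef (n : nat) : (2 * k < n)%nat -> D (S n) = - 4 * eta * (a n * eta ^ n).
Proof.
  intros Hn. unfold D.
  rewrite !mono_add, !mono_mul. unfold fps_sub, fps_add.
  rewrite fps_mul_mono. unfold mono, scale.
  destruct (Nat.eqb_spec (S n) 0); [lia|]. destruct (Nat.eqb_spec (S n) 1); [lia|].
  destruct (Nat.eqb_spec (S n) (0 + 1 + 2 * k)); [lia|].
  destruct (Nat.leb_spec (0 + 0 + 1) (S n)); [|lia].
  replace (S n - (0 + 0 + 1))%nat with n by lia. ring.
Qed.

Lemma a_asymp : is_lim_seq (fun n => a n / asym k eta n) 1.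
Proof.
  pose proof PI_RGT_0 as Hpi. pose proof psik_pos as Hpsi.
  assert (Hspi : 0 < sqrt PI) by now apply sqrt_lt_R0.
  assert (Hspsi : 0 < sqrt (psik k eta)) by now apply sqrt_lt_R0.
  pose proof D_asymp as HD. apply is_lim_seq_incr_1 in HD.
  (* After the index shift [D_asymp] carries the weight of [n + 2]; this factor converts it to that
     of [n], as in [asym]. *)
  assert (Ht : is_lim_seq (fun n => pow32 (INR n / (INR n + 2))) (pow32 1)).
  { apply is_lim_seq_pow32; [lra|].
    apply (is_lim_seq_rational (fun t => (1 - t) / (1 + t))).
    - apply derivable_continuous_pt, ex_derive_Reals_0. auto_derive. lra.
    - field.
    - intros n. pose proof (pos_INR n). field. lra. }
  replace 1 with (- 2 * sqrt PI / sqrt (psik k eta)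
    * ((- / (2 * sqrt PI) * sqrt (psik k eta)) * pow32 1))
    by (unfold pow32; rewrite sqrt_1; field; lra).
  eapply is_lim_seq_ext_loc; [|apply (is_lim_seq_mult' (fun _ => _)
     _ _ _ (is_lim_seq_const _) (is_lim_seq_mult' _ _ _ _ HD Ht))].
  exists (S (2 * k)). intros n Hn. rewrite D_coef by lia.
  assert (HN : 0 < INR n) by (apply lt_0_INR; lia).
  rewrite S_INR, Rmult_assoc, <- pow32_mult by lra.
  replace ((INR n + 1 + 1) * (INR n / (INR n + 2))) with (INR n) by (field; lra).
  unfold asym. replace (- 3 / 2) with (- (1 + / 2)) by field.
  rewrite Rpower_Ropp, Rpower_plus, Rpower_1, Rpower_sqrt by trivial.
  unfold pow32. pose proof (sqrt_lt_R0 _ HN). pose proof (pow_lt eta n Heta0).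
  field. repeat split; lra.
Qed.

End Asymptotics.

Theorem theorem2 (k : nat) (Hk : (2 <= k)%nat) (a : nat -> nat)
  (Ha : forall n : nat, exists l : list re,
          NoDup l /\ length l = a n /\
          forall e : re, In e l <-> (letters_ok k e /\ re_na k e /\ rsize e = n))
  (eta : R) (Heta0 : 0 < eta) (Heta1 : eta < 1 / sqrt (8 + 8 * INR k))
  (Hroot : Deltak k eta = 0) :
  is_lim_seq (fun n : nat => INR (a n) / asym k eta n) 1.
Proof.
  apply (a_asymp k (fun n => INR (a n)) eta); trivial.
  apply fps_equation; [lia|]. intros n.
  destruct (Ha n) as (l & Hl & <- & El). exists l. auto.
Qed.
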